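(* Let $\rho>0$ and let $A,B\in\mathbb{R}^{n\times n}$ be in the block form described in the context, with $\mathcal{P}^\epsilon_c$, $\mathcal{A}_c$, $S_\epsilon$ and $r$ as defined there. (i) For any $\mu\in\mathcal{A}_c$ and $\delta>0$ there exists $0<\epsilon_0\le 1/\rho$ such that whenever $0<\epsilon<\epsilon_0$ there exists $\lambda\in\mathcal{P}^\epsilon_c$ satisfying $|S_\epsilon(\lambda)-\mu|<\delta$. (ii) Let $R>0$. For any $0<\delta\le r$ there exists $0<\epsilon_0\le 1/\rho$ such that whenever $0<\epsilon<\epsilon_0$ and $\lambda\in\mathcal{P}^\epsilon_c$ with $|\mathrm{Im}(\lambda)|<R$, we have $|\mathrm{Re}(\lambda)|<\delta$ and there exists $\mu\in\mathcal{A}_c$ such that $|S_\epsilon(\lambda)-\mu|<\delta$.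
   Context: The underlying delay differential equation is $u'(t)=A\,u(t)+\frac{B}{2\rho}\int_{\tau_{\rm m}-\rho}^{\tau_{\rm m}+\rho}u(t-s)\,ds$, $u(t)\in\mathbb{R}^n$, with mean delay $\tau_{\rm m}=1/\epsilon\ge\rho$. Its characteristic function is $\Delta(\lambda;\epsilon)=\det\left(\lambda I_n-A-B\,e^{-\lambda/\epsilon}\,\mathrm{sinhc}(\lambda\rho)\right)$, where $\mathrm{sinhc}(x)=\sinh(x)/x$ for $x\ne0$, $\mathrm{sinhc}(0)=1$. Also $\mathrm{sinc}(x)=\sin(x)/x$ for $x\neq0$, $\mathrm{sinc}(0)=1$. Block form: $B=\begin{bmatrix}0&0\\ 0&\bar B\end{bmatrix}$ with $\bar B\in\mathbb{R}^{d\times d}$ invertible, $1\le d\le n$, and $A=\begin{bmatrix}A_1&A_2\\ A_3&A_4\end{bmatrix}$ with $A_1\in\mathbb{R}^{(n-d)\times(n-d)}$, $A_4\in\mathbb{R}^{d\times d}$ (if $d=n$, $A_1$ is empty and $\sigma(A_1)=\emptyset$). $\sigma(M)$ is the set of eigenvalues of $M$. $p_\omega(x)=\det\left(i\omega I_n-A-x\,\mathrm{sinc}(\rho\omega)\,B\right)$, a polynomial in $x$, for $\omega\in\mathbb{R}$. Strong critical spectrum: $\mathcal{A}_0=\{i\omega:\omega\in\mathbb{R},\ i\omega\in\sigma(A)\text{ and }p_\omega(x)=0\text{ for all }x\in\mathbb{C}\}$. Asymptotic strong spectra: $\mathcal{A}_+=\{\lambda\in\sigma(A):\Re\lambda>0\}$,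 $\mathcal{A}_-=\{\lambda\in\sigma(A_1):\Re\lambda<0\}$, $\mathcal{A}_s=\mathcal{A}_+\cup\mathcal{A}_-$. Asymptotic continuous spectrum: $\mathcal{A}_c=\mathrm{closure}\{\gamma+i\omega\in\mathbb{C}:\gamma,\omega\in\mathbb{R},\ i\omega\notin\mathcal{A}_0\text{ and }\exists\varphi\in\mathbb{R}:\ p_\omega(e^{-\gamma}e^{-i\varphi})=0\}$. $r:=\frac13\min\{r_0,\operatorname{dist}(\mathcal{A}_s,i\mathbb{R})\}$ with $r_0:=\min\{|\lambda-\mu|:\lambda,\mu\in\mathcal{A}_s,\lambda\ne\mu\}$ (minimum and distance over the empty set are $+\infty$). For $M\subset\mathbb{C}$, $\mathcal{B}_r(M)=\bigcup_{x\in M}\{z\in\mathbb{C}:|z-x|<r\}$. Spectrum: $\mathcal{P}^\epsilon=\{\lambda\in\mathbb{C}:\Delta(\lambda;\epsilon)=0\}$. Strong spectrum: $\mathcal{P}^\epsilon_s=\mathcal{P}^\epsilon_+\cup\mathcal{P}^\epsilon_-$, with $\mathcal{P}^\epsilon_\pm=\mathcal{P}^\epsilon\cap\mathcal{B}_r(\mathcal{A}_\pm)$. Pseudo-continuous spectrum: $\mathcal{P}^\epsilon_c=\mathcal{P}^\epsilon\setminus(\mathcal{P}^\epsilon_s\cup\mathcal{A}_0)$. Rescaling: $S_\epsilon(a+ib)=\frac{a}{\epsilon}+ib$ for $a,b\in\mathbb{R}$. *)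

(* Defs.v *)
From HB Require Import structures.
From mathcomp Require Import all_boot all_order all_algebra.
From mathcomp Require Import complex.
From mathcomp Require Import all_classical all_reals all_analysis.
Import numFieldNormedType.Exports.

Set Implicit Arguments.
Unset Strict Implicit.
Unset Printing Implicit Defensive.

Import Order.TTheory GRing.Theory Num.Theory.

Local Open Scope classical_set_scope.
Local Open Scope ring_scope.
Local Open Scope complex_scope.

Section ComplexFunctions.
Context {R : realType}.
Implicit Types (x : R) (z : R[i]).

(* The modulus as an element of [R]; the norm [`|z|] of the normed field [R[i]]
   is [(cmod z)%:C], so [closure] on [R[i]^o] is the usual one. *)
Definition cmod z : R := ComplexField.Normc.normc z.

Definition cexp z : R[i] :=
  (expR (complex.Re z) * cos (complex.Im z)) +i*
  (expR (complex.Re z) * sin (complex.Im z)).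

Definition csinh z : R[i] := (cexp z - cexp (- z)) / 2%:R.

Definition sinhc z : R[i] := if z == 0 then 1 else csinh z / z.

Definition sinc x : R := if x == 0 then 1 else sin x / x.

Definition imag_axis : set R[i] := [set z | complex.Re z = 0].

Definition mx_spectrum n (M : 'M[R]_n) : set R[i] :=
  [set z | eigenvalue (map_mx (real_complex R) M) z].

(* With [ereal_inf], minima and distances over empty sets are [+oo]. *)
Definition min_gap (M : set R[i]) : \bar R :=
  ereal_inf [set e | exists z w, [/\ M z, M w, z <> w & e = (cmod (z - w))%:E]].

Definition set_dist (M N : set R[i]) : \bar R :=
  ereal_inf [set e | exists z w, [/\ M z, N w & e = (cmod (z - w))%:E]].

Definition ball_nbhd (r : \bar R) (M : set R[i]) : set R[i] :=
  [set z | exists2 x, M x & ((cmod (z - x))%:E < r)%E].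

Definition rescale (eps : R) z : R[i] :=
  (complex.Re z / eps) +i* complex.Im z.

End ComplexFunctions.

(* The size of the system is written [m + d] with [m = n - d], so that
   [ulsubmx A : 'M_m] is the block [A_1] (empty when [m = 0]). *)
Section Spectra.
Context {R : realType} {m d : nat}.
Variables (rho : R) (A B : 'M[R]_(m + d)).

Local Notation Ac := (map_mx (real_complex R) A).
Local Notation Bc := (map_mx (real_complex R) B).

Definition char_fun (eps : R) (l : R[i]) : R[i] :=
  \det (l%:M - Ac - (cexp (- (l / eps%:C)) * sinhc (l * rho%:C)) *: Bc).

Definition p_omega (w : R) (x : R[i]) : R[i] :=
  \det ((0 +i* w)%:M - Ac - (x * (sinc (rho * w))%:C) *: Bc).

Definition strong_critical : set R[i] :=
  [set z | exists w : R, [/\ z = 0 +i* w, mx_spectrum A (0 +i* w)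
                           & forall x : R[i], p_omega w x = 0]].

Definition asym_plus : set R[i] :=
  [set l | mx_spectrum A l /\ 0 < complex.Re l].

Definition asym_minus : set R[i] :=
  [set l | mx_spectrum (ulsubmx A) l /\ complex.Re l < 0].

Definition asym_strong : set R[i] := asym_plus `|` asym_minus.

Definition asym_continuous : set R[i] :=
  closure ([set z | exists g w : R,
    [/\ z = g +i* w, ~ strong_critical (0 +i* w)
      & exists phi : R,
          p_omega w (cexp (- g%:C) * cexp (- (0 +i* phi))) = 0]]
           : set R[i]^o).

Definition sep_radius : \bar R :=
  ((3^-1)%:E * mine (min_gap asym_strong) (set_dist asym_strong imag_axis))%E.

Definition spectrum (eps : R) : set R[i] := [set l | char_fun eps l = 0].

Definition strong_plus (eps : R) : set R[i] :=
  spectrum eps `&` ball_nbhd sep_radius asym_plus.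

Definition strong_minus (eps : R) : set R[i] :=
  spectrum eps `&` ball_nbhd sep_radius asym_minus.

Definition strong_spectrum (eps : R) : set R[i] :=
  strong_plus eps `|` strong_minus eps.

Definition pseudo_continuous (eps : R) : set R[i] :=
  spectrum eps `\` (strong_spectrum eps `|` strong_critical).

End Spectra.

(* Main.v *)
(** Write [P x l = det (l - A - x B)], a polynomial in both variables of degree
    [d] in [x] whose constant and leading coefficients in [x] are the
    characteristic polynomials of [A] and, up to a nonzero factor, of [A_1]; a
    point [l] of the spectrum is a solution of [P x l = 0] with
    [x = exp (- l / eps) * sinhc (l rho)].

    If [Re l >= delta] then [x] is exponentially small in [1 / eps], so [l] is
    close to a root of the constant coefficient; if [Re l <= - delta] then
    [1 / x] is exponentially small and [l] is close to a root of the leading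
    coefficient. Hence [l] belongs to the strong spectrum.

    Near a point [i b] of the axis, [sinhc (l rho) = (l - i b)^n h l] with
    [h (i b) <> 0], and dividing [P] by the largest possible power of [l - i b]
    gives [P (y sinhc (l rho)) l = (l - i b)^j H (h l * y) l] where [H] does not
    vanish identically at [l = i b]. A root [z] of [H] at [l] near [i b] has
    nearly the same modulus as some root of [H] at a nearby point of the axis:
    this is persistence of roots for [z] in a compact subset of [C \ {0}], and the
    intermediate value theorem for the smallest root modulus when [z] tends to
    [0], or to infinity after reversing [H]. Compactness of [[- R, R]] makes the
    statement uniform.

    Conversely, for [l = i w_eps + eps (g + u)] with [w_eps] close to [w] and
    chosen so that [exp (- i w_eps / eps)] has the prescribed phase, the
    characteristic function converges uniformly in [u] to a nonzero function
    vanishing at [u = 0]. It has a zero near [0] by the minimum modulus principle,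
    which is elementary for polynomials and passes to uniform limits of
    polynomials. *)

Require Import Defs.
From mathcomp Require Import all_boot all_order all_algebra.
From mathcomp Require Import complex.
From mathcomp Require Import all_classical all_reals all_analysis.
From mathcomp Require Import ring lra.
Import Order.TTheory GRing.Theory Num.Theory.
Import numFieldNormedType.Exports.
Local Open Scope classical_set_scope.
Local Open Scope ring_scope.
Local Open Scope complex_scope.

Set Implicit Arguments.
Unset Strict Implicit.
Unset Printing Implicit Defensive.

(** * The real-valued modulus of complex numbers *)

Section Modulus.
Context {R : realType}.
Implicit Types (x y z w : R[i]) (a b : R).

Lemma cmodM x y : cmod (x * y) = cmod x * cmod y.
Proof. exact: ComplexField.Normc.normcM. Qed.

Lemma cmod_le_add x y : cmod (x + y) <= cmod x + cmod y.
Proof. exact: le_normcD. Qed.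

Lemma cmodN x : cmod (- x) = cmod x.
Proof. exact: normcN. Qed.

Lemma cmodV x : cmod x^-1 = (cmod x)^-1.
Proof. exact: ComplexField.Normc.normcV. Qed.

Lemma cmod0 : cmod 0 = 0 :> R.
Proof. exact: ComplexField.Normc.normc0. Qed.

Lemma cmod1 : cmod 1 = 1 :> R.
Proof. exact: ComplexField.Normc.normc1. Qed.

Lemma cmod_ge0 x : 0 <= cmod x.
Proof. by case: x => a b; exact: sqrtr_ge0. Qed.

Lemma cmod_eq0 x : (cmod x == 0) = (x == 0).
Proof.
by apply/eqP/eqP => [/ComplexField.Normc.eq0_normc//|->]; exact: cmod0.
Qed.

Lemma cmod_gt0 x : (0 < cmod x) = (x != 0).
Proof. by rewrite lt_def cmod_eq0 cmod_ge0 andbT. Qed.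

Lemma cmod_real a : cmod a%:C = `|a|.
Proof. by rewrite /cmod /= expr0n addr0 sqrtr_sqr. Qed.

Lemma cmod_imag b : cmod (0 +i* b) = `|b|.
Proof. by rewrite /cmod /= expr0n add0r sqrtr_sqr. Qed.

Lemma cmodX x n : cmod (x ^+ n) = cmod x ^+ n.
Proof. by elim: n => [|n IH]; rewrite ?expr0 ?cmod1 // !exprS cmodM IH. Qed.

Lemma cmodB x y : cmod (x - y) = cmod (y - x).
Proof. by rewrite -cmodN opprB. Qed.

Lemma cmod_le_sub x y : cmod (x - y) <= cmod x + cmod y.
Proof. by rewrite -(cmodN y) cmod_le_add. Qed.

Lemma cmod_sub_ge x y : cmod x - cmod y <= cmod (x - y).
Proof. by rewrite lerBlDr -{1}(subrK y x) cmod_le_add. Qed.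

Lemma cmod_dist z x y : cmod (x - y) <= cmod (x - z) + cmod (z - y).
Proof. by apply: le_trans (cmod_le_add _ _); rewrite addrA subrK. Qed.

Lemma Re_le_cmod z : `|complex.Re z| <= cmod z.
Proof.
by case: z => a b; rewrite -sqrtr_sqr /cmod /= ler_wsqrtr // lerDl sqr_ge0.
Qed.

Lemma Im_le_cmod z : `|complex.Im z| <= cmod z.
Proof.
by case: z => a b; rewrite -sqrtr_sqr /cmod /= ler_wsqrtr // lerDr sqr_ge0.
Qed.

Lemma cmod_le_ReIm z : cmod z <= `|complex.Re z| + `|complex.Im z|.
Proof.
case: z => a b; have {1}-> : a +i* b = a%:C + (0 +i* b) by simpc.
by rewrite (le_trans (cmod_le_add _ _)) // cmod_real cmod_imag.
Qed.

Lemma ReB x y : complex.Re (x - y) = complex.Re x - complex.Re y.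
Proof. by case: x y => a b [c d]. Qed.

Lemma ImB x y : complex.Im (x - y) = complex.Im x - complex.Im y.
Proof. by case: x y => a b [c d]. Qed.

Lemma cmod_prod (s : seq R[i]) (f : R[i] -> R[i]) :
  cmod (\prod_(u <- s) f u) = \prod_(u <- s) cmod (f u).
Proof. by elim: s => [|u s IH]; rewrite ?big_nil ?cmod1 // !big_cons cmodM IH. Qed.

Lemma normrC_cmod z : `|z| = (cmod z)%:C.
Proof. by case: z. Qed.

(** Values that are not positive are skipped, so applied to the distances from a point to the roots
    of a polynomial it gives an isolation radius even when the point is itself a root. *)
Lemma seq_pos_lower_bound (T : eqType) (s : seq T) (f : T -> R) :
  exists2 k, 0 < k & forall v, v \in s -> 0 < f v -> k <= f v.
Proof.
elim: s => [|v s [k k0 IH]]; first by exists 1.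
have [fv|fv] := ltP 0 (f v); last first.
  exists k => // w; rewrite in_cons => /orP[/eqP->|/IH//].
  by rewrite ltNge fv.
exists (Num.min k (f v)); first by rewrite lt_min k0.
move=> w; rewrite in_cons => /orP[/eqP-> _|ws fw]; first by rewrite ge_min lexx orbT.
by rewrite ge_min IH.
Qed.

End Modulus.

(** * Roots of complex polynomials in one variable *)

Section UnivariateRoots.
Context {R : realType}.
Local Notation C := (R[i]).
Implicit Types (p q : {poly C}) (x z u : C) (s : R).

Lemma poly_roots p : p != 0 ->
  exists2 r : seq C, p = lead_coef p *: \prod_(u <- r) ('X - u%:P) &
    size p = (size r).+1.
Proof.
move=> p0; have [r pr] := closed_field_poly_normal p; exists r => //.
by rewrite pr size_scale ?lead_coef_eq0 // size_prod_XsubC.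
Qed.

Lemma cmod_horner_roots p (r : seq C) z :
  p = lead_coef p *: \prod_(u <- r) ('X - u%:P) ->
  cmod p.[z] = cmod (lead_coef p) * \prod_(u <- r) cmod (z - u).
Proof.
move=> pr; rewrite {1}pr hornerZ cmodM horner_prod cmod_prod; congr (_ * _).
by apply: eq_bigr => u _; rewrite hornerXsubC.
Qed.

Lemma root_prod p (r : seq C) u : p != 0 ->
  p = lead_coef p *: \prod_(u <- r) ('X - u%:P) -> root p u = (u \in r).
Proof. by move=> p0 pr; rewrite pr rootZ ?lead_coef_eq0 // root_prod_XsubC. Qed.

(** Every linear factor has modulus at least [s], so the leading coefficient times a power of [s]
    serves as [c]. *)
Lemma nonroot_lower_bound p s : p != 0 -> 0 < s ->
  exists2 c, 0 < c & forall z,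
    (forall u, root p u -> s <= cmod (z - u)) -> c <= cmod p.[z].
Proof.
move=> p0 s0; have [r pr _] := poly_roots p0.
exists (cmod (lead_coef p) * s ^+ size r) => [|z zr].
  by rewrite mulr_gt0 ?exprn_gt0 // cmod_gt0 lead_coef_eq0.
rewrite (cmod_horner_roots _ pr) ler_wpM2l ?cmod_ge0 //.
have {}zr u : u \in r -> s <= cmod (z - u) by rewrite -(root_prod _ p0 pr); exact: zr.
elim: r zr {pr} => [|u r IH] zr; first by rewrite big_nil.
rewrite big_cons exprS ler_pM ?exprn_ge0 ?(ltW s0) //; first exact/zr/mem_head.
by apply: IH => v vr; rewrite zr // in_cons vr orbT.
Qed.

Lemma near_root p s : p != 0 -> 0 < s ->
  exists2 c, 0 < c & forall z, cmod p.[z] < c ->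
    exists2 u, root p u & cmod (z - u) < s.
Proof.
move=> p0 s0; have [c c0 H] := nonroot_lower_bound p0 s0; exists c => // z.
apply: contraPP => zr; apply/negP; rewrite -leNgt; apply: H => u ru.
by rewrite leNgt; apply/negP => zu; apply: zr; exists u.
Qed.

(* If every root [u] satisfies [s <= |u - y|] then each linear factor at most
   doubles when moving from [y] to a point at distance at most [s]. *)
Lemma root_of_growth p D x y s : (size p <= D.+1)%N ->
  cmod (x - y) <= s -> 2 ^+ D * cmod p.[y] < cmod p.[x] ->
  exists2 u, root p u & cmod (u - y) < s.
Proof.
move=> pD xy pyx; have p0 : p != 0.
  apply: contraTneq pyx => ->; rewrite !horner0 cmod0 mulr0 ltxx //.
have [r pr szr] := poly_roots p0.
apply: contrapT => nr.
have {}nr u : u \in r -> s <= cmod (u - y).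
  rewrite -(root_prod _ p0 pr) => ru; rewrite leNgt; apply/negP => zu.
  by apply: nr; exists u.
move: pyx; apply/negP; rewrite -leNgt !(cmod_horner_roots _ pr) mulrCA.
rewrite ler_wpM2l ?cmod_ge0 //.
have rD : (size r <= D)%N by rewrite -ltnS -szr.
apply: (@le_trans _ _ (2 ^+ size r * \prod_(u <- r) cmod (y - u))); last first.
  rewrite ler_wpM2r ?prodr_ge0 // => [u _|]; first exact: cmod_ge0.
  by rewrite ler_weXn2l // ler1n.
elim: r nr {pr szr rD} => [|u r IH] nr; first by rewrite !big_nil expr0 mul1r.
rewrite !big_cons exprS mulrACA ler_pM ?cmod_ge0 ?prodr_ge0 // => [v _| |].
- exact: cmod_ge0.
- have := nr u (mem_head _ _); have := cmod_dist y x u; rewrite (cmodB u) mulr_natl mulr2n.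
  by move: xy; lra.
- by apply: IH => v vr; rewrite nr // in_cons vr orbT.
Qed.

Lemma isolated_roots p y : p != 0 ->
  exists2 s, 0 < s & forall x, 0 < cmod (x - y) < s -> p.[x] != 0.
Proof.
move=> p0; have [r pr _] := poly_roots p0.
have [s s0 H] := seq_pos_lower_bound r (fun u => cmod (u - y)).
exists s => // x /andP[x0 xs]; apply: contraTneq xs => px.
by rewrite -leNgt H // -(root_prod _ p0 pr); apply/eqP.
Qed.

Lemma nonroot_near p y s : p != 0 -> 0 < s ->
  exists2 x, cmod (x - y) <= s & p.[x] != 0.
Proof.
move=> p0 s0; have [t t0 H] := isolated_roots y p0.
pose m := Num.min s (t / 2).
have m0 : 0 < m by rewrite lt_min s0 divr_gt0.
exists (y + m%:C).
  by rewrite addrC addKr cmod_real ger0_norm ?(ltW m0) // ge_min lexx.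
apply: H; rewrite addrC addKr cmod_real ger0_norm ?(ltW m0) // m0 /=.
by rewrite gt_min; apply/orP; right; lra.
Qed.

Lemma poly_eq0_punctured p : (forall x, x != 0 -> p.[x] = 0) -> p = 0.
Proof.
move=> H; apply/eqP; apply: contraT => p0.
have [s s0 Hs] := isolated_roots 0 p0.
have sE : cmod (s / 2)%:C = s / 2 by rewrite cmod_real ger0_norm; lra.
have /Hs : 0 < cmod ((s / 2)%:C - 0) < s by rewrite subr0 sE; lra.
by rewrite H ?eqxx // -cmod_gt0 sE; lra.
Qed.

End UnivariateRoots.

(** * Polynomials in an unknown and a parameter *)

Section BivariatePolynomials.
Context {R : realType}.
Local Notation C := (R[i]).
Implicit Types (p q : {poly C}) (G : {poly {poly C}}) (a l x z u : C).

(** Throughout, the outer variable of [G] is the unknown and its coefficients are polynomials in the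
    parameter: [G.[z, a]] has unknown [z] and parameter [a]. *)
Definition at_param a G : {poly C} := map_poly (horner_eval a) G.

Lemma horner_at_param a G z : (at_param a G).[z] = G.[z, a].
Proof.
by rewrite /at_param -[z in LHS](hornerC z a) -[_.[a]]/(horner_eval a _) horner_map.
Qed.

Lemma size_at_param a G : (size (at_param a G) <= size G)%N.
Proof. exact: size_poly. Qed.

Lemma horner2_MXaddC G q z l :
  (G * 'X + q%:P).[z, l] = G.[z, l] * z + q.[l].
Proof. by rewrite !hornerE. Qed.

Lemma horner2_0 G l : G.[0, l] = (G`_0).[l].
Proof. by rewrite polyC0 horner_coef0. Qed.

Lemma poly_lipschitz p (K : R) : 0 <= K ->
  exists2 L, 0 < L & forall x y, cmod x <= K -> cmod y <= K ->
    cmod p.[x] <= L /\ cmod (p.[x] - p.[y]) <= L * cmod (x - y).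
Proof.
move=> K0; elim/poly_ind: p => [|p c [L L0 IH]].
  by exists 1 => // x y _ _; rewrite !horner0 subr0 cmod0 mul1r cmod_ge0.
exists (L * K + L + cmod c) => [|x y xK yK].
  by have := cmod_ge0 c; have := mulr_ge0 (ltW L0) K0; lra.
have [px pxy] := IH x y xK yK; have [py _] := IH y x yK xK.
rewrite !hornerE; split.
  rewrite (le_trans (cmod_le_add _ _)) // cmodM.
  have : cmod p.[x] * cmod x <= L * K by rewrite ler_pM ?cmod_ge0.
  by lra.
have -> : p.[x] * x + c - (p.[y] * y + c) = (p.[x] - p.[y]) * x + p.[y] * (x - y).
  by ring.
rewrite (le_trans (cmod_le_add _ _)) // !cmodM !mulrDl -!addrA lerD //.
  by rewrite mulrAC ler_pM ?cmod_ge0.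
by rewrite ler_wpDr ?mulr_ge0 ?cmod_ge0 // ler_wpM2r ?cmod_ge0.
Qed.

Lemma biv_lipschitz G (K : R) : 0 <= K ->
  exists2 L, 0 < L & forall x y l m, cmod x <= K -> cmod y <= K ->
    cmod l <= K -> cmod m <= K ->
    cmod G.[x, l] <= L /\
    cmod (G.[x, l] - G.[y, m]) <= L * (cmod (x - y) + cmod (l - m)).
Proof.
move=> K0; elim/poly_ind: G => [|G q [L L0 IH]].
  exists 1 => // x y l m _ _ _ _; rewrite !horner0 subr0 cmod0 mul1r.
  by rewrite addr_ge0 ?cmod_ge0.
have [L' L'0 Hq] := poly_lipschitz q K0.
have LK := mulr_ge0 (ltW L0) K0.
exists (L * K + L + L') => [|x y l m xK yK lK mK]; first by lra.
have [Gx Gxy] := IH x y l m xK yK lK mK; have [Gy _] := IH y x m l yK xK mK lK.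
have [ql qlm] := Hq l m lK mK.
rewrite !horner2_MXaddC; split.
  rewrite (le_trans (cmod_le_add _ _)) // cmodM.
  have : cmod G.[x, l] * cmod x <= L * K by rewrite ler_pM ?cmod_ge0.
  by lra.
set gx := G.[_].[l] in Gx Gxy *; set gy := G.[_].[m] in Gy Gxy *.
have -> : gx * x + q.[l] - (gy * y + q.[m]) =
  (gx - gy) * x + gy * (x - y) + (q.[l] - q.[m]) by ring.
rewrite (le_trans (cmod_le_add _ _)) //.
rewrite (le_trans (lerD (cmod_le_add _ _) (lexx _))) // !cmodM !mulrDl.
have xy0 := cmod_ge0 (x - y); have lm0 := cmod_ge0 (l - m).
apply: lerD.
  apply: lerD; first by rewrite mulrAC ler_pM ?cmod_ge0.
  rewrite (@le_trans _ _ (L * cmod (x - y))) ?ler_wpM2r //.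
  by rewrite mulrDr lerDl mulr_ge0 // ltW.
by rewrite (le_trans qlm) // mulrDr lerDr mulr_ge0 // ltW.
Qed.

(** Polynomial growth is coarsened to exponential growth so that it can be absorbed into the decay
    of [exp (- l / eps)] by adding exponents, even where [Re l] is unbounded. *)
Lemma poly_exp_growth p : exists c : R, exists N : nat, 0 < c /\
  forall l, cmod p.[l] <= c * expR (N%:R * cmod l).
Proof.
elim/poly_ind: p => [|p q [c [N [c0 IH]]]].
  by exists 1, 0%N; split=> // l; rewrite horner0 cmod0 mul1r expR_ge0.
exists (c + cmod q), N.+1; split=> [|l]; first by rewrite ltr_pwDl ?cmod_ge0.
rewrite !hornerE (le_trans (cmod_le_add _ _)) // cmodM -natr1.
rewrite [(_ + 1) * cmod l]mulrDl mul1r expRD mulrDl; apply: lerD.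
  rewrite mulrA ler_pM ?cmod_ge0 //.
  by apply: le_trans (expR_ge1Dx _); rewrite lerDr ler01.
rewrite -expRD ler_peMr ?cmod_ge0 // -expR0 ler_expR addr_ge0 ?mulr_ge0 ?cmod_ge0 //.
Qed.

Lemma biv_exp_growth G : exists c : R, exists N : nat, 0 < c /\
  forall x l, cmod x <= 1 -> cmod G.[x, l] <= c * expR (N%:R * cmod l).
Proof.
elim/poly_ind: G => [|G q [c [N [c0 IH]]]].
  by exists 1, 0%N; split=> // x l _; rewrite !horner0 cmod0 mul1r expR_ge0.
have [c' [N' [c'0 Hq]]] := poly_exp_growth q.
exists (c + c'), (N + N')%N; split=> [|x l x1]; first by rewrite addr_gt0.
rewrite horner2_MXaddC (le_trans (cmod_le_add _ _)) // cmodM natrD.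
rewrite [(_ + _) * cmod l]mulrDl expRD.
have eN (k : nat) : 1 <= expR (k%:R * cmod l).
  by rewrite -expR0 ler_expR mulr_ge0 ?cmod_ge0.
rewrite mulrDl; apply: lerD.
  rewrite (@le_trans _ _ (cmod G.[x, l])) ?ler_piMr ?cmod_ge0 //.
  by rewrite (le_trans (IH _ _ x1)) // mulrA ler_peMr ?mulr_ge0 ?expR_ge0 // ltW.
by rewrite (le_trans (Hq _)) // ler_wpM2l ?(ltW c'0) // ler_peMl ?expR_ge0.
Qed.

(** Writing [G = G' * X + q], a root satisfies [q(l) = - x G'(x, l)], and [G'] grows at most
    exponentially in [l] on [|x| <= 1]. *)
Lemma const_coef_le_at_root G : exists c : R, exists N : nat, 0 < c /\
  forall x l, cmod x <= 1 -> G.[x, l] = 0 ->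
    cmod (G`_0).[l] <= cmod x * (c * expR (N%:R * cmod l)).
Proof.
elim/poly_ind: G => [|G q _].
  exists 1, 0%N; split=> // x l _ _.
  by rewrite coef0 horner0 cmod0 mul1r mulr_ge0 ?cmod_ge0 ?expR_ge0.
have [c [N [c0 H]]] := biv_exp_growth G.
exists c, N; split=> // x l x1; rewrite horner2_MXaddC => /eqP.
rewrite addrC addr_eq0 => /eqP qE.
have -> : (G * 'X + q%:P)`_0 = q by rewrite coefD coefMX coefC add0r.
by rewrite qE cmodN cmodM mulrC ler_wpM2l ?cmod_ge0 // H.
Qed.

Lemma biv_subst_poly G p q : exists r : {poly C}, forall u,
  G.[p.[u], q.[u]] = r.[u].
Proof.
elim/poly_ind: G => [|G s [r IH]]; first by exists 0 => u; rewrite !horner0.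
exists (r * p + (s \Po q)) => u.
by rewrite horner2_MXaddC IH hornerD hornerM horner_comp.
Qed.

(** Reversal in the unknown for the formal degree [n]. It exchanges the roots [z] and [z^-1], so
    that results on small roots apply to large ones. *)
Definition rev_poly n G : {poly {poly C}} := \poly_(k < n.+1) G`_(n - k).

Lemma rev_poly_coef0 n G : (rev_poly n G)`_0 = G`_n.
Proof. by rewrite coef_poly /= subn0. Qed.

Lemma horner2_rev n G z l : (size G <= n.+1)%N -> z != 0 ->
  G.[z, l] = z ^+ n * (rev_poly n G).[z^-1, l].
Proof.
move=> sG z0; rewrite -!horner_at_param.
have sp : (size (at_param l G) <= n.+1)%N := leq_trans (size_at_param _ _) sG.
have sr : (size (at_param l (rev_poly n G)) <= n.+1)%N.
  by rewrite (leq_trans (size_at_param _ _)) // size_poly.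
rewrite (horner_coef_wide _ sp) (horner_coef_wide _ sr) mulr_sumr.
rewrite (reindex_inj rev_ord_inj) /=; apply: eq_bigr => k _.
rewrite !coef_map coef_poly subSS ltn_ord mulrCA; congr (_ * _).
have kn : (k <= n)%N by rewrite -ltnS.
have -> : z ^+ n = z ^+ (n - k) * z ^+ k by rewrite -exprD subnK.
by rewrite -mulrA -exprMn divff // expr1n mulr1.
Qed.

Lemma at_param_neq0 a G k : (G`_k).[a] != 0 -> at_param a G != 0.
Proof.
apply: contraNneq => H.
by rewrite -[_.[a]]/(horner_eval a _) -coef_map -/(at_param a G) H coef0.
Qed.

(** As long as [G] vanishes identically at the parameter [a], all its coefficients are divisible by
    ['X - a%:P]. Each division lowers the degree of the leading coefficient in the parameter, so the
    process stops. *)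
Lemma biv_factor_param G a : G != 0 ->
  exists j : nat, exists2 H, G = (('X - a%:P) ^+ j)%:P * H & at_param a H != 0.
Proof.
move: {2}(size (lead_coef G)) (leqnn (size (lead_coef G))) => n.
elim: n G => [|n IH] G sG G0.
  by move: sG; rewrite leqn0 size_poly_eq0 lead_coef_eq0 (negbTE G0).
have [Ga|Ga] := eqVneq (at_param a G) 0; last by exists 0%N, G => //; rewrite expr0 mul1r.
pose H := \poly_(k < size G) (G`_k %/ ('X - a%:P)).
have GH : G = ('X - a%:P)%:P * H.
  apply/polyP => k; rewrite coefCM coef_poly; case: ltnP => [_|ks]; last first.
    by rewrite mulr0 nth_default.
  rewrite mulrC divpK // dvdp_XsubCl /root -[_.[a]]/(horner_eval a _) -coef_map.
  by rewrite -/(at_param a G) Ga coef0.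
have H0 : H != 0 by apply: contraNneq G0 => H0; rewrite GH H0 mulr0.
have [||j [H' HH' H'a]] := IH H => //.
  rewrite -ltnS; apply: leq_trans sG; rewrite GH lead_coefM lead_coefC.
  by rewrite mulrC size_Mmonic ?monicXsubC ?lead_coef_eq0 // size_XsubC addn2.
exists j.+1, H' => //.
by rewrite GH HH' mulrA -polyCM exprS.
Qed.

End BivariatePolynomials.

(** * Dependence of roots on the parameter, in particular along the imaginary axis *)

Section RootsOfFamilies.
Context {R : realType}.
Local Notation C := (R[i]).
Implicit Types (G : {poly {poly C}}) (a l x y z u : C) (b w s t e T : R).

(** If [G.[z, l] = 0] then [|G.[z, a]| <= L * |l - a|] by the Lipschitz bound, uniformly in
    [|z| <= T], and a polynomial is small only near its roots. *)
Lemma near_root_of_family G a T s : at_param a G != 0 -> 0 < s ->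
  exists2 e, 0 < e & forall l z, cmod (l - a) < e -> cmod z <= T ->
    G.[z, l] = 0 -> exists2 u, root (at_param a G) u & cmod (z - u) < s.
Proof.
move=> G0 s0; have [c c0 Hc] := near_root G0 s0.
have K0 : 0 <= `|T| + cmod a + 1 by rewrite !addr_ge0 ?cmod_ge0.
have [L L0 HL] := biv_lipschitz G K0.
exists (Num.min 1 (c / L)) => [|l z]; first by rewrite lt_min ltr01 divr_gt0.
rewrite lt_min ltr_pdivlMr // mulrC => /andP[la1 lac] zT Gzl.
apply: Hc; rewrite horner_at_param -[_.[a]]subr0 -Gzl.
have aK : cmod a <= `|T| + cmod a + 1 by have := normr_ge0 T; lra.
have lK : cmod l <= `|T| + cmod a + 1.
  by have := normr_ge0 T; have := cmod_dist a l 0; rewrite !subr0; lra.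
have zK : cmod z <= `|T| + cmod a + 1.
  by have := ler_norm T; have := cmod_ge0 a; lra.
have [_] := HL z z a l zK zK aK lK.
by rewrite subrr cmod0 add0r (cmodB a); move: lac; lra.
Qed.

(** At a point [x] near [y] with [G.[x, a] != 0] the value stays away from 0 for [l] near [a], while
    [G.[y, l]] tends to 0. Once the ratio exceeds [2 ^+ D], [root_of_growth] forces a root near
    [y]. *)
Lemma root_persists G a y s : at_param a G != 0 -> G.[y, a] = 0 -> 0 < s ->
  exists2 e, 0 < e & forall l, cmod (l - a) < e ->
    exists2 z, cmod (z - y) < s & G.[z, l] = 0.
Proof.
move=> G0 Gya s0; have [x xy px] := nonroot_near y G0 s0.
pose K := cmod x + cmod y + cmod a + 1.
have K0 : 0 <= K by rewrite !addr_ge0 ?cmod_ge0.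
have [L L0 HL] := biv_lipschitz G K0.
pose D := size G; pose m := cmod G.[x, a].
have m0 : 0 < m by rewrite /m cmod_gt0 -horner_at_param.
have D0 : 0 < 2 ^+ D + 1 :> R by rewrite addr_gt0 ?exprn_gt0.
exists (Num.min 1 (m / ((2 ^+ D + 1) * L))) => [|l].
  by rewrite lt_min ltr01 divr_gt0 // mulr_gt0.
rewrite lt_min ltr_pdivlMr ?mulr_gt0 // => /andP[la1 lam].
have xK : cmod x <= K by rewrite /K; have := cmod_ge0 y; have := cmod_ge0 a; clear; lra.
have yK : cmod y <= K by rewrite /K; have := cmod_ge0 x; have := cmod_ge0 a; clear; lra.
have aK : cmod a <= K by rewrite /K; have := cmod_ge0 x; have := cmod_ge0 y; clear; lra.
have lK : cmod l <= K.
  rewrite /K; move: la1; have := cmod_ge0 x; have := cmod_ge0 y.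
  by have := cmod_dist a l 0; rewrite !subr0; clear; lra.
have [_] := HL x x a l xK xK aK lK; rewrite subrr cmod0 add0r (cmodB a) => Gx.
have [_] := HL y y l a yK yK lK aK; rewrite subrr cmod0 add0r Gya subr0 => Gy.
have [||z rz zy] := @root_of_growth _ (at_param l G) D x y s _ xy.
- by rewrite (leq_trans (size_at_param _ _)).
- rewrite !horner_at_param.
  have := cmod_sub_ge G.[x, a] (G.[x, a] - G.[x, l]); rewrite subKr -/m.
  have : 2 ^+ D * cmod G.[y, l] <= 2 ^+ D * (L * cmod (l - a)).
    by rewrite ler_wpM2l // exprn_ge0.
  have : 2 ^+ D * (L * cmod (l - a)) + L * cmod (l - a) < m.
    by apply: le_lt_trans lam; rewrite le_eqVlt; apply/orP; left; apply/eqP; ring.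
  by move: Gx; clear; lra.
- by exists z => //; rewrite -horner_at_param; apply/eqP.
Qed.

Lemma cmod_imag_sub w b : cmod ((0 +i* w : C) - 0 +i* b) = `|w - b|.
Proof. by rewrite -cmod_imag; congr cmod; simpc. Qed.

(* [w] is the supremum of the parameters in [[b, v]] with a root of modulus at
   most [t]: this set is closed, and by persistence of roots a root of modulus
   smaller than [t] would allow to increase [w]. *)
Lemma root_of_modulus G b v t : b <= v -> 0 < t ->
  (forall w, b <= w <= v -> at_param (0 +i* w) G != 0) ->
  G.[0, 0 +i* b] = 0 ->
  (forall z, cmod z <= t -> G.[z, 0 +i* v] != 0) ->
  exists w z, [/\ b <= w <= v, cmod z = t & G.[z, 0 +i* w] = 0].
Proof.
move=> bv t0 Gw Gb Gv.
pose E := [set w | b <= w <= v /\ exists2 z, cmod z <= t & G.[z, 0 +i* w] = 0].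
have Eb : E b by split; [rewrite lexx|exists 0; rewrite ?cmod0 ?ltW].
have Ev : ubound E v by move=> w [/andP[]].
have supE : has_sup E by split; [exists b|exists v].
set w := sup E.
have bw : b <= w by apply: ub_le_sup => //; exists v.
have wv : w <= v by apply: ge_sup => //; exists b.
have Gw0 : at_param (0 +i* w) G != 0 by rewrite Gw // bw.
(* The supremum belongs to [E]: otherwise every root at [w] has modulus at least [t + k], whereas
   parameters of [E] close to [w] have roots of modulus at most [t] at distance less than [k] from
   one of these. *)
have [z zt Gz] : exists2 z, cmod z <= t & G.[z, 0 +i* w] = 0.
  apply: contrapT => nz.
  have [r pr _] := poly_roots Gw0.
  have [k k0 Hk] := seq_pos_lower_bound r (fun u => cmod u - t).
  have [e e0 He] := near_root_of_family t Gw0 k0.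
  have [w' [/andP[bw' w'v] [z zt Gz]] ww'] := sup_adherent e0 supE.
  have w'w : w' <= w by apply: ub_le_sup; [exists v|split; [rewrite bw'|exists z]].
  have [|u ru zu] := He _ z _ zt Gz.
    by rewrite cmod_imag_sub ler0_norm; move: ww'; rewrite -/w; lra.
  have ut : t < cmod u.
    rewrite ltNge; apply/negP => ut; apply: nz; exists u => //.
    by rewrite -horner_at_param; apply/eqP.
  have := Hk u; rewrite -(root_prod _ Gw0 pr) subr_gt0 => /(_ ru ut).
  by have := cmod_sub_ge u z; rewrite (cmodB u); lra.
exists w, z; split=> //; first by rewrite bw.
apply/eqP; rewrite eq_le zt /= leNgt; apply/negP => zlt.
have [|e e0 He] := root_persists Gw0 Gz (s := t - cmod z); first by lra.
have wltv : w < v.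
  rewrite lt_neqAle wv andbT; apply/eqP => wv'.
  by have /eqP[] := Gv z zt; rewrite -wv'.
pose w' := Num.min (w + e / 2) v.
have ww' : w < w' by rewrite lt_min wltv andbT; lra.
have w'e : w' <= w + e / 2 by rewrite ge_min lexx.
have [|z' z'z Gz'] := He (0 +i* w').
  by rewrite cmod_imag_sub ger0_norm; lra.
suff : w' <= w by lra.
apply: ub_le_sup; first by exists v.
split; first by rewrite ge_min lexx orbT andbT; lra.
by exists z' => //; have := cmod_dist z z' 0; rewrite !subr0; lra.
Qed.

(** If [0] is not a root at [i b], there are no small roots nearby. If it is, the constant
    coefficient is nonzero just above [b], so some [i (b + h)] has no small root and
    [root_of_modulus] realizes every small modulus in between. The parameter found differs from [b]
    because the nonzero roots at [i b] are bounded away from [0]. *)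
Lemma small_roots_on_axis G b k : G`_0 != 0 ->
  at_param (0 +i* b) G != 0 -> 0 < k ->
  exists t e, [/\ 0 < t, 0 < e & forall l z, cmod (l - 0 +i* b) < e ->
    0 < cmod z <= t -> G.[z, l] = 0 ->
    exists w z', [/\ 0 < `|w - b| < k, cmod z' = cmod z & G.[z', 0 +i* w] = 0]].
Proof.
move=> G00 Gb k0; have [s s0 Hs] := isolated_roots 0 Gb.
have {}Hs z : 0 < cmod z < s -> G.[z, 0 +i* b] != 0.
  by rewrite -horner_at_param => zs; apply: Hs; rewrite subr0.
have [Gb0|Gb0] := eqVneq G.[0, 0 +i* b] 0; last first.
  have s20 : 0 < s / 2 by lra.
  have [e e0 He] := near_root_of_family (s / 2) Gb s20.
  exists (s / 2), e; split=> // l z lb /andP[z0 zs] Gzl.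
  have [u ru zu] := He l z lb zs Gzl.
  have Gu : G.[u, 0 +i* b] = 0 by rewrite -horner_at_param; apply/eqP.
  have [u0|u0] := eqVneq u 0; first by have /eqP[] := Gb0; rewrite -[RHS]Gu u0.
  have /Hs/eqP[//] : 0 < cmod u < s.
  by rewrite cmod_gt0 u0 /=; have := cmod_sub_ge u z; rewrite (cmodB u); lra.
have [r r0 Hr] := isolated_roots (0 +i* b) G00.
pose h := Num.min k r / 2; have h0 : 0 < h by rewrite divr_gt0 // lt_min k0.
have hk : h < k.
  have : Num.min k r <= k by rewrite ge_min lexx.
  by move: h0; rewrite /h; clear; lra.
have hr : h < r.
  have : Num.min k r <= r by rewrite ge_min lexx orbT.
  by move: h0; rewrite /h; clear; lra.
have Gw w : b < w <= b + h -> G.[0, 0 +i* w] != 0.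
  move=> /andP[bw wh]; rewrite horner2_0; apply: Hr.
  by rewrite cmod_imag_sub ger0_norm; lra.
have Gw0 w : b <= w <= b + h -> at_param (0 +i* w) G != 0.
  rewrite le_eqVlt => /andP[/orP[/eqP<- //|bw] wh].
  by apply: (@at_param_neq0 _ _ _ 0); rewrite -horner2_0 Gw // bw.
have Gv0 : at_param (0 +i* (b + h)) G != 0 by apply: Gw0; rewrite lexx; lra.
have [s' s'0 Hs'] := isolated_roots 0 Gv0.
exists (Num.min s s' / 2), 1; split=> //; first by rewrite divr_gt0 // lt_min s0.
move=> l z _ /andP[z0 zt] _.
have zs : cmod z < s.
  have : Num.min s s' <= s by rewrite ge_min lexx.
  by lra.
have zs' : cmod z < s'.
  have : Num.min s s' <= s' by rewrite ge_min lexx orbT.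
  by lra.
have [|x xz|w [z' [/andP[bw wh] z'z Gz']]] := @root_of_modulus G b (b + h) (cmod z) _ z0 Gw0 Gb0.
- by lra.
- have [->|x0] := eqVneq x 0; first by apply: Gw; rewrite lexx; lra.
  rewrite -horner_at_param; apply: Hs'; rewrite subr0 cmod_gt0 x0 /=; lra.
exists w, z'; split=> //; rewrite ger0_norm; last by lra.
apply/andP; split; last by lra.
rewrite subr_gt0 lt_neqAle bw andbT; apply/eqP => bw'.
have /Hs/eqP[] : 0 < cmod z' < s by rewrite z'z z0.
by rewrite bw'.
Qed.

(* Roots close to [0], roots of large modulus (via the reversed polynomial) and
   the remaining ones, which stay near roots of the limit polynomial, are
   treated separately. *)
Lemma roots_on_axis n G b k : (size G <= n.+1)%N -> G`_0 != 0 -> G`_n != 0 ->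
  at_param (0 +i* b) G != 0 -> 0 < k ->
  exists2 e, 0 < e & forall l z, cmod (l - 0 +i* b) < e -> z != 0 ->
    G.[z, l] = 0 -> exists w z', [/\ 0 < `|w - b| < k, z' != 0,
      G.[z', 0 +i* w] = 0, cmod z' <= (1 + k) * cmod z
      & cmod z <= (1 + k) * cmod z'].
Proof.
move=> sG G00 G0n Gb k0.
have [t [e1 [t0 e10 H1]]] := small_roots_on_axis G00 Gb k0.
have rb : at_param (0 +i* b) (rev_poly n G) != 0.
  apply: contraNneq Gb => rb0; apply/eqP/poly_eq0_punctured => x x0.
  by rewrite horner_at_param (horner2_rev _ sG x0) -horner_at_param rb0 horner0 mulr0.
have r00 : (rev_poly n G)`_0 != 0 by rewrite rev_poly_coef0.
have [T [e2 [T0 e20 H2]]] := small_roots_on_axis r00 rb k0.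
have k1E z : cmod z <= (1 + k) * cmod z.
  by rewrite ler_peMl ?cmod_ge0 //; lra.
(* For a root of modulus above [t], a displacement below [2 * s] changes the modulus by a factor of
   at most [1 + k] in either direction. *)
pose s := Num.min 1 k * t / 8.
have s0 : 0 < s by rewrite !mulr_gt0 ?invr_gt0 // lt_min ltr01.
have sk : 8 * s <= k * t.
  have : Num.min 1 k * t <= k * t by rewrite ler_pM2r // ge_min lexx orbT.
  by rewrite /s; lra.
have st : 8 * s <= t.
  have : Num.min 1 k * t <= 1 * t by rewrite ler_pM2r // ge_min lexx.
  by rewrite /s; lra.
have [e3 e30 H3] := near_root_of_family T^-1 Gb s0.
exists (Num.min e1 (Num.min e2 e3)) => [|l z]; first by rewrite !lt_min e10 e20.
rewrite !lt_min => /and3P[l1 l2 l3] z0 Gz.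
have cz0 : 0 < cmod z by rewrite cmod_gt0.
have [zt|tz] := leP (cmod z) t.
  have [|w [z' [wb z'z Gz']]] := H1 l z l1 _ Gz; first by rewrite cz0.
  by exists w, z'; split=> //; rewrite -?cmod_gt0 ?z'z // k1E.
have [zT|Tz] := leP (cmod z) T^-1; last first.
  have Gr : (rev_poly n G).[z^-1, l] = 0.
    have /eqP := Gz; rewrite (horner2_rev _ sG z0) mulf_eq0 expf_eq0 (negbTE z0) andbF.
    by move/eqP.
  have [|w [z' [wb z'z Gz']]] := H2 l z^-1 l2 _ Gr.
    rewrite cmodV invr_gt0 cz0 /= -[T]invrK lef_pV2 ?posrE ?invr_gt0 //.
    exact: ltW.
  have z'0 : z' != 0 by rewrite -cmod_gt0 z'z cmodV invr_gt0.
  exists w, z'^-1; rewrite cmodV z'z cmodV invrK; split=> //.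
    by rewrite invr_eq0.
  by rewrite (horner2_rev _ sG) ?invr_eq0 // invrK Gz' mulr0.
have [u ru zu] := H3 l z l3 zT Gz.
have Gu : G.[u, 0 +i* b] = 0 by rewrite -horner_at_param; apply/eqP.
(* The root [z] is within [s] of a root [u] at [i b], and [u] is followed to the parameter [b + h];
   [h > 0] keeps this parameter different from [b]. *)
have [e e0 He] := root_persists Gb Gu s0.
pose h := Num.min e k / 2; have h0 : 0 < h by rewrite divr_gt0 // lt_min e0.
have hk : h < k.
  have : Num.min e k <= k by rewrite ge_min lexx orbT.
  by move: h0; rewrite /h; clear; lra.
have he : h < e.
  have : Num.min e k <= e by rewrite ge_min lexx.
  by move: h0; rewrite /h; clear; lra.
have [|z' z'u Gz'] := He (0 +i* (b + h)).
  by rewrite cmod_imag_sub ger0_norm; move: h0 he; clear; lra.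
have z'z : cmod (z' - z) < 2 * s by have := cmod_dist u z' z; rewrite (cmodB u); move: zu z'u; clear; lra.
have lo := cmod_sub_ge z z'; have hi := cmod_sub_ge z' z; rewrite cmodB in lo.
have kz : k * t <= k * cmod z by rewrite ler_pM2l // ltW.
have kz' : k * (t / 2) <= k * cmod z'.
  by rewrite ler_pM2l //; move: t0 tz z'z lo st; clear; lra.
exists (b + h), z'; split=> //.
- by rewrite ger0_norm; move: h0 hk; clear; lra.
- by rewrite -cmod_gt0; move: tz z'z lo st t0; clear; lra.
- by rewrite mulrDl mul1r; move: hi z'z sk kz s0; clear; lra.
- by rewrite mulrDl mul1r; move: lo z'z sk kz' s0; clear; lra.
Qed.

End RootsOfFamilies.

(** * Estimates and polynomial approximations of the exponential and of [sinhc] *)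

Section ComplexExponential.
Context {R : realType}.
Local Notation C := (R[i]).
Implicit Types (x y z w : C) (a b : R) (p q : {poly C}).

Lemma cmod_sqr z : cmod z ^+ 2 = complex.Re z ^+ 2 + complex.Im z ^+ 2.
Proof. by case: z => a b; rewrite sqr_sqrtr // addr_ge0 ?sqr_ge0. Qed.

Lemma cexpD x y : cexp (x + y) = cexp x * cexp y.
Proof.
case: x y => [a b] [c d]; rewrite /cexp /= expRD cosD sinD.
by apply/eqP; rewrite eq_complex /=; apply/andP; split; apply/eqP; ring.
Qed.

Lemma cexp0 : cexp 0 = 1 :> C.
Proof. by rewrite /cexp /= expR0 cos0 sin0 mul1r mulr0. Qed.

Lemma cmod_cexp z : cmod (cexp z) = expR (complex.Re z).
Proof.
rewrite /cmod /= !exprMn -mulrDr cos2Dsin2 mulr1 sqrtr_sqr.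
by rewrite ger0_norm ?expR_ge0.
Qed.

Lemma cexp_neq0 z : cexp z != 0.
Proof. by rewrite -cmod_gt0 cmod_cexp expR_gt0. Qed.

Lemma cmod_cexp_le z : cmod (cexp z) <= expR (cmod z).
Proof. by rewrite cmod_cexp ler_expR (le_trans (ler_norm _)) // Re_le_cmod. Qed.

Lemma cexpX z n : cexp (z *+ n) = cexp z ^+ n.
Proof. by elim: n => [|n IH]; rewrite ?mulr0n ?cexp0 // mulrS exprS cexpD IH. Qed.

Lemma cexp_real a : cexp a%:C = (expR a)%:C.
Proof. by rewrite /cexp /= cos0 sin0 mulr1 mulr0. Qed.

Lemma cexp_imag b : cexp (0 +i* b) = cos b +i* sin b.
Proof. by rewrite /cexp /= expR0 !mul1r. Qed.

(** The phase is [acos (Re y / |y|)] up to a sign determined by that of [Im y]. The exponents have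
    the form used in [asym_continuous], with [g = - ln |y|]. *)
Lemma cexp_polar y : y != 0 ->
  exists phi, y = cexp (- (- ln (cmod y))%:C) * cexp (- (0 +i* phi)).
Proof.
move=> y0; have cy : 0 < cmod y by rewrite cmod_gt0.
have -> : - (- ln (cmod y))%:C = (ln (cmod y))%:C by rewrite -rmorphN opprK.
rewrite cexp_real lnK //.
have oi phi : - (0 +i* phi) = 0 +i* (- phi) :> C by simpc.
case: y y0 cy => a b _ cy; set r := cmod _ in cy *.
have r2 : r ^+ 2 = a ^+ 2 + b ^+ 2 by rewrite cmod_sqr.
have ar : - 1 <= a / r <= 1.
  rewrite -ler_norml normrM normfV (ger0_norm (ltW cy)) ler_pdivrMr // mul1r.
  exact: (Re_le_cmod (a +i* b)).
have rn0 : r != 0 by rewrite gt_eqF.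
have sr : Num.sqrt (1 - (a / r) ^+ 2) = `|b| / r.
  have -> : 1 - (a / r) ^+ 2 = (`|b| / r) ^+ 2.
    rewrite !exprMn real_normK ?num_real // (_ : b ^+ 2 = r ^+ 2 - a ^+ 2).
      by field.
    by rewrite r2; ring.
  by rewrite sqrtr_sqr ger0_norm // divr_ge0 // ltW.
have ca : cos (acos (a / r)) = a / r by rewrite acosK // in_itv.
have sa : sin (acos (a / r)) = `|b| / r by rewrite sin_acos.
have rC (c s : R) : a = r * c -> b = r * s -> a +i* b = r%:C * (c +i* s).
  by move=> -> ->; simpc.
have [b0|b0] := leP 0 b.
  exists (- acos (a / r)); rewrite oi opprK cexp_imag ca sa.
  by apply: rC; rewrite ?ger0_norm // mulrC mulfVK.
exists (acos (a / r)); rewrite oi cexp_imag cosN sinN ca sa.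
by apply: rC; rewrite ?ltr0_norm // mulrC ?mulNr ?opprK mulfVK.
Qed.

Lemma sin_MVT b : exists2 c, `|c| <= `|b| & sin b = cos c * b.
Proof.
wlog b0 : b / 0 <= b => [H|].
  have [/H//|b0] := leP 0 b.
  have [|c cb sE] := H (- b); first by lra.
  exists c; first by rewrite -(normrN b).
  by rewrite -[b in LHS]opprK sinN sE mulrN opprK.
have [|c cb] := @MVT_segment R sin cos 0 b b0 (fun c _ => is_derive_sin c).
  by apply: continuous_subspaceT => t; exact: continuous_sin.
rewrite sin0 !subr0 => sE; exists c => //.
by move: cb; rewrite in_itv /= => /andP[c0 cb]; rewrite !ger0_norm.
Qed.

Lemma sin_le_norm b : `|sin b| <= `|b|.
Proof.
have [c _ ->] := sin_MVT b; rewrite normrM ler_piMl ?cos_max //.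
Qed.

Lemma cos_dist1 b : `|cos b - 1| <= b ^+ 2 / 2.
Proof.
have cE : cos b - 1 = - (sin (b / 2) ^+ 2 *+ 2).
  have -> : cos b = cos ((b / 2) *+ 2) by congr cos; rewrite -mulr_natr mulfVK.
  by rewrite cos_mulr2n cos2sin2; ring.
have h : `|sin (b / 2)| ^+ 2 <= (b / 2) ^+ 2.
  by rewrite -[leRHS]real_normK ?num_real // lerXn2r ?nnegrE // sin_le_norm.
rewrite cE normrN normrMn normrX -[_ *+ 2]mulr_natr.
have -> : b ^+ 2 / 2 = (b / 2) ^+ 2 * 2 by field.
by rewrite ler_wpM2r.
Qed.

Lemma sin_dist b : `|b| <= 1 / 2 -> `|sin b - b| <= b ^+ 2 / 2.
Proof.
move=> b1; have [c cb ->] := sin_MVT b.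
have -> : cos c * b - b = (cos c - 1) * b by ring.
rewrite normrM; have := cos_dist1 c.
have cb2 : c ^+ 2 <= b ^+ 2.
  rewrite -[c ^+ 2]real_normK ?num_real // -[b ^+ 2]real_normK ?num_real //.
  by rewrite lerXn2r ?nnegrE.
move=> h; have : `|cos c - 1| * `|b| <= b ^+ 2 / 2 * 1; last by rewrite mulr1.
by apply: ler_pM => //; lra.
Qed.

(** Multiplying [1 - a <= expR (- a)] by [expR a] gives [expR a - 1 - a <= a^2 / (1 - a)], and
    [1 - a >= 1 / 2]. *)
Lemma expR_dist a : `|a| <= 1 / 2 -> `|expR a - 1 - a| <= 2 * a ^+ 2.
Proof.
rewrite ler_norml => /andP[a1 a2].
have e1 := expR_ge1Dx a; have e2 := expR_ge1Dx (- a).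
rewrite ger0_norm; last by lra.
have e0 := expR_gt0 a.
have h : expR a * (1 - a) <= 1.
  by rewrite -[leRHS](expRxMexpNx_1 a) ler_wpM2l ?expR_ge0.
nra.
Qed.

(** The real and imaginary parts of the error are sums of quadratically small terms; with
    [2 |a b| <= a^2 + b^2] they add up to at most [3 |w|^2]. *)
Lemma cexp_taylor1 w : cmod w <= 1 / 2 ->
  cmod (cexp w - 1 - w) <= 4 * cmod w ^+ 2.
Proof.
move=> w1; rewrite cmod_sqr.
have := le_trans (Re_le_cmod w) w1; have := le_trans (Im_le_cmod w) w1.
case: w {w1} => a b; rewrite [complex.Re _]/= [complex.Im _]/= => b1 a1.
have := expR_dist a1; have := sin_dist b1; have := cos_dist1 b.
set E := expR a; set s := sin b; set c := cos b => hc hs hE.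
have E2 : `|E| <= 2.
  rewrite (_ : E = (E - 1 - a) + 1 + a); last by ring.
  rewrite (le_trans (ler_normD _ _)) // (le_trans (lerD (ler_normD _ _) (lexx _))) //.
  rewrite normr1; have : a ^+ 2 <= 1 / 4; last by lra.
  rewrite -[a ^+ 2]real_normK ?num_real //; have := normr_ge0 a; nra.
have E1 : `|E - 1| <= 2 * `|a|.
  rewrite (_ : E - 1 = (E - 1 - a) + a); last by ring.
  rewrite (le_trans (ler_normD _ _)) //.
  move: hE; rewrite -[a ^+ 2]real_normK ?num_real //; have := normr_ge0 a; nra.
have -> : cexp (a +i* b) - 1 - a +i* b = (E * c - 1 - a) +i* (E * s - b).
  by rewrite /cexp /=; apply/eqP; rewrite eq_complex /= oppr0 addr0 !eqxx.
rewrite (le_trans (cmod_le_ReIm _)) //=.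
have -> : E * c - 1 - a = (E - 1 - a) + E * (c - 1) by ring.
have -> : E * s - b = E * (s - b) + (E - 1) * b by ring.
apply: (le_trans (lerD (ler_normD _ _) (ler_normD _ _))); rewrite !normrM.
have t1 : `|E| * `|c - 1| <= 2 * (b ^+ 2 / 2) by apply: ler_pM.
have t2 : `|E| * `|s - b| <= 2 * (b ^+ 2 / 2) by apply: ler_pM.
have t3 : `|E - 1| * `|b| <= 2 * `|a| * `|b| by rewrite ler_wpM2r.
move: t1 t2 t3 hE; rewrite -[a ^+ 2]real_normK ?num_real // -[b ^+ 2]real_normK ?num_real //.
have := sqr_ge0 (`|a| - `|b|); nra.
Qed.

Lemma cexp_dist1 w : cmod w <= 1 / 8 ->
  cmod w / 2 <= cmod (cexp w - 1) <= 2 * cmod w.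
Proof.
move=> w8; have w0 := cmod_ge0 w.
have t : cmod (cexp w - 1 - w) <= 4 * cmod w ^+ 2 by apply: cexp_taylor1; lra.
have t' : 4 * cmod w ^+ 2 <= cmod w / 2 by nra.
have := cmod_sub_ge w (w - (cexp w - 1)); rewrite subKr (cmodB w) => lo.
have := cmod_le_add (cexp w - 1 - w) w; rewrite subrK => hi.
apply/andP; split; lra.
Qed.

(** Euler's polynomials, which converge to the exponential. *)
Definition cexp_poly n : {poly C} := (1 + (n%:R^-1) *: 'X) ^+ n.

Lemma horner_cexp_poly n z : (cexp_poly n).[z] = (1 + z / n%:R) ^+ n.
Proof. by rewrite horner_exp !hornerE mulrC. Qed.

Lemma cmod_1Dz z n : cmod (1 + z / n%:R) <= expR (cmod z / n%:R).
Proof.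
rewrite (le_trans (cmod_le_add _ _)) // cmod1 cmodM cmodV.
have -> : cmod (n%:R : C) = n%:R.
  by rewrite -(rmorph_nat (real_complex R)) cmod_real ger0_norm.
exact: expR_ge1Dx.
Qed.

Lemma cmod_natr n : cmod (n%:R : C) = n%:R.
Proof. by rewrite -(rmorph_nat (real_complex R)) cmod_real ger0_norm. Qed.

Lemma cmod_sum n (f : 'I_n -> C) : cmod (\sum_i f i) <= \sum_i cmod (f i).
Proof.
elim/big_rec2: _ => [|i y x _ IH]; first by rewrite cmod0.
by rewrite (le_trans (cmod_le_add _ _)) // lerD2l.
Qed.

Lemma cmod_geom_sum n (x y : C) (m : R) : cmod x <= expR m -> cmod y <= expR m ->
  0 <= m ->
  cmod (\sum_(i < n) x ^+ (n.-1 - i) * y ^+ i) <= n%:R * expR (m * n%:R).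
Proof.
move=> xm ym m0; rewrite (le_trans (cmod_sum _)) //.
apply: (@le_trans _ _ (\sum_(i < n) expR (m * n%:R))); last first.
  by rewrite sumr_const card_ord mulr_natl.
apply: ler_sum => i _; rewrite cmodM !cmodX.
apply: (@le_trans _ _ (expR m ^+ (n.-1 - i) * expR m ^+ i)).
  by rewrite ler_pM ?exprn_ge0 ?cmod_ge0 // lerXn2r ?nnegrE ?cmod_ge0 ?expR_ge0.
rewrite -exprD -expRM_natr ler_expR ler_wpM2l // ler_nat.
by rewrite subnK ?leq_pred // -ltnS prednK ?ltn_ord // (leq_ltn_trans _ (ltn_ord i)).
Qed.

(** Factor [a^n - b^n] with [a = cexp (z / n)] and [b = 1 + z / n]: the difference [a - b] is of
    order [|z|^2 / n^2], and each of the [n] terms of the cofactor is bounded by [expR |z|]. *)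
Lemma cexp_poly_dist n z : (0 < n)%N -> cmod z / n%:R <= 1 / 2 ->
  cmod (cexp z - (cexp_poly n).[z]) <= 4 * cmod z ^+ 2 / n%:R * expR (cmod z).
Proof.
move=> n0 zn; have n0' : 0 < n%:R :> R by rewrite ltr0n.
have nC : (n%:R : C) != 0 by rewrite -cmod_gt0 cmod_natr.
have cz : cmod (z / n%:R) = cmod z / n%:R by rewrite cmodM cmodV cmod_natr.
rewrite horner_cexp_poly.
have -> : cexp z = cexp (z / n%:R) ^+ n.
  by rewrite -cexpX -[_ / _ *+ n]mulr_natr mulfVK.
rewrite subrXX cmodM.
have zE : cmod z / n%:R * n%:R = cmod z by rewrite mulfVK // gt_eqF.
have h1 := @cmod_geom_sum n (cexp (z / n%:R)) (1 + z / n%:R) (cmod z / n%:R).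
rewrite zE in h1.
have {}h1 : cmod (\sum_(i < n) cexp (z / n%:R) ^+ (n.-1 - i) * (1 + z / n%:R) ^+ i)
  <= n%:R * expR (cmod z).
  by apply: h1; rewrite ?cmod_1Dz ?divr_ge0 ?cmod_ge0 // -cz cmod_cexp_le.
have h2 : cmod (cexp (z / n%:R) - (1 + z / n%:R)) <= 4 * (cmod z / n%:R) ^+ 2.
  by rewrite opprD addrA -cz cexp_taylor1 // cz.
apply: le_trans (ler_pM (cmod_ge0 _) (cmod_ge0 _) h2 h1) _.
rewrite le_eqVlt; apply/orP; left; apply/eqP; field.
by rewrite gt_eqF.
Qed.

(** The quotient [((1 + z / n)^n - (1 - z / n)^n) / (2 z)], expanded as a geometric sum to remove
    the division by [z]. *)
Definition sinhc_poly n : {poly C} := (n%:R^-1) *: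
  \sum_(i < n) (1 + (n%:R^-1) *: 'X) ^+ (n.-1 - i) * (1 - (n%:R^-1) *: 'X) ^+ i.

Lemma horner_sinhc_poly n z : (sinhc_poly n).[z] =
  (\sum_(i < n) (1 + z / n%:R) ^+ (n.-1 - i) * (1 - z / n%:R) ^+ i) / n%:R.
Proof.
rewrite hornerZ horner_sum mulrC; congr (_ * _); apply: eq_bigr => i _.
by rewrite hornerM !horner_exp !hornerE ![_^-1 * z]mulrC.
Qed.

Lemma sinhc_poly_dist n z : (0 < n)%N -> cmod z / n%:R <= 1 / 2 ->
  cmod (sinhc z - (sinhc_poly n).[z]) <= 4 * cmod z / n%:R * expR (cmod z).
Proof.
move=> n0 zn; have n0' : 0 < n%:R :> R by rewrite ltr0n.
have nC : (n%:R : C) != 0 by rewrite -cmod_gt0 cmod_natr.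
have [->|z0] := eqVneq z 0.
  rewrite /sinhc eqxx horner_sinhc_poly !mul0r addr0 subr0.
  under eq_bigr do rewrite !expr1n mulr1.
  by rewrite sumr_const card_ord divff // subrr cmod0 !mulr0 !mul0r.
have cz : 0 < cmod z by rewrite cmod_gt0.
have zS : z * (sinhc_poly n).[z] = ((cexp_poly n).[z] - (cexp_poly n).[- z]) / 2%:R.
  rewrite horner_sinhc_poly !horner_cexp_poly mulNr subrXX.
  have -> : 1 + z / n%:R - (1 - z / n%:R) = 2%:R * z / n%:R by field.
  by field; rewrite nC.
have -> : sinhc z - (sinhc_poly n).[z] =
    ((cexp z - (cexp_poly n).[z]) - (cexp (- z) - (cexp_poly n).[- z])) / 2%:R / z.
  rewrite /sinhc (negbTE z0) /csinh -[(sinhc_poly n).[z]](mulKf z0) zS.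
  by field.
have h1 := cexp_poly_dist n0 zn.
have h2 : cmod (cexp (- z) - (cexp_poly n).[- z]) <= 4 * cmod z ^+ 2 / n%:R * expR (cmod z).
  by rewrite -(cmodN z) cexp_poly_dist // cmodN.
rewrite !cmodM !cmodV (cmod_natr 2) ler_pdivrMr // ler_pdivrMr //.
rewrite (le_trans (cmod_le_sub _ _)) // (le_trans (lerD h1 h2)) //.
by rewrite le_eqVlt; apply/orP; left; apply/eqP; field; rewrite gt_eqF.
Qed.

(** For [n > 2 |z|] the approximating polynomial is bounded by [expR |z|] and the approximation
    error by [2 expR |z|]. *)
Lemma cmod_sinhc_le z : cmod (sinhc z) <= 3 * expR (cmod z).
Proof.
have [n zn] : exists n : nat, 2 * cmod z < n%:R.
  by exists (Num.bound (2 * cmod z)); rewrite archi_boundP // mulr_ge0 ?cmod_ge0.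
have n0' : 0 < n%:R :> R by have := cmod_ge0 z; lra.
have n0 : (0 < n)%N by rewrite -(ltr0n R).
have zn2 : cmod z / n%:R <= 1 / 2 by rewrite ler_pdivrMr //; lra.
have h := sinhc_poly_dist n0 zn2.
have hS : cmod (sinhc_poly n).[z] <= expR (cmod z).
  rewrite horner_sinhc_poly cmodM cmodV cmod_natr ler_pdivrMr // [leRHS]mulrC.
  have -> : expR (cmod z) = expR (cmod z / n%:R * n%:R) by rewrite mulfVK // gt_eqF.
  apply: cmod_geom_sum; rewrite ?divr_ge0 ?cmod_ge0 //; first exact: cmod_1Dz.
  by rewrite -mulNr -(cmodN z) cmod_1Dz.
have : 4 * cmod z / n%:R * expR (cmod z) <= 2 * expR (cmod z).
  by rewrite ler_wpM2r ?expR_ge0 // -mulrA; lra.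
by have := cmod_le_add (sinhc z - (sinhc_poly n).[z]) (sinhc_poly n).[z]; rewrite subrK; lra.
Qed.

(** With [a = Re z], [|exp z - exp (- z)|] is at least [|exp a - exp (- a)|], hence at least [|a|].
    In particular [sinhc] vanishes only on the imaginary axis. *)
Lemma cmod_sinhc_ge z : `|complex.Re z| <= 2 * cmod z * cmod (sinhc z).
Proof.
have [->|z0] := eqVneq z 0; first by rewrite cmod0 mulr0 mul0r normr0.
rewrite /sinhc (negbTE z0) /csinh !cmodM !cmodV (cmod_natr 2).
have cz : cmod z != 0 by rewrite cmod_eq0.
have -> : 2 * cmod z * (cmod (cexp z - cexp (- z)) / 2 / cmod z) =
  cmod (cexp z - cexp (- z)) by field.
have h1 := cmod_sub_ge (cexp z) (cexp (- z)).
have h2 := cmod_sub_ge (cexp (- z)) (cexp z).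
rewrite cmodB in h2; move: h1 h2; rewrite !cmod_cexp.
have -> : complex.Re (- z) = - complex.Re z by case: (z).
set a := complex.Re z; have := expR_ge1Dx a; have := expR_ge1Dx (- a).
have [a0|a0] := leP 0 a.
  by rewrite ger0_norm //; have := (expR_le1 (- a)); lra.
by rewrite ltr0_norm //; have := (expR_le1 a); lra.
Qed.

Lemma sinhc_imag b : sinhc (0 +i* b) = (sinc b)%:C.
Proof.
rewrite /sinhc /sinc /csinh eq_complex /= eqxx /=; case: eqP => // /eqP b0.
have -> : - (0 +i* b) = 0 +i* (- b) :> C by simpc.
rewrite !cexp_imag cosN sinN.
have ib : (0 +i* b : C) != 0 by rewrite eq_complex /= eqxx.
apply: (mulIf ib); rewrite mulfVK //.
apply: (@mulIf _ 2%:R); first by rewrite -cmod_gt0 (cmod_natr 2).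
rewrite mulfVK ?pnatr_eq0 //.
apply/eqP; rewrite eq_complex /=; apply/andP; split; apply/eqP; field => //.
Qed.

End ComplexExponential.

(** * Uniform limits of polynomials and the minimum modulus principle *)

Section ApproximationByPolynomials.
Context {R : realType}.
Local Notation C := (R[i]).
Implicit Types (f g : C -> C) (x y z u : C) (p q : {poly C}) (K e s t : R).

(** These are the entire functions, described as locally uniform limits of polynomials. *)
Definition poly_approximable f := forall K e, 0 < e ->
  exists p, forall z, cmod z <= K -> cmod (f z - p.[z]) < e.

Lemma poly_approximable_of_rate f (c : R -> R) (F : nat -> {poly C}) :
  (forall n z, (0 < n)%N -> cmod z / n%:R <= 1 / 2 ->
    cmod (f z - (F n).[z]) <= c (cmod z) / n%:R) ->
  {homo c : s t / s <= t} -> poly_approximable f.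
Proof.
move=> Hf cm K e e0; pose K' := `|K|; pose M := Num.max (2 * K') (`|c K'| / e).
have K'0 : 0 <= K' := normr_ge0 K.
have M0 : 0 <= M by rewrite le_max mulr_ge0.
exists (F (Num.bound M).+1) => z zK; set n := (Num.bound M).+1.
have nM : M < n%:R.
  by rewrite (lt_le_trans (archi_boundP M0)) // ler_nat leqnSn.
have n0 : 0 < n%:R :> R by rewrite ltr0n.
have zK' : cmod z <= K' := le_trans zK (ler_norm K).
have n1 : 2 * K' < n%:R by apply: le_lt_trans nM; rewrite le_max lexx.
have n2 : `|c K'| / e < n%:R by apply: le_lt_trans nM; rewrite le_max lexx orbT.
apply: (@le_lt_trans _ _ (c (cmod z) / n%:R)).
  by apply: Hf => //; rewrite ler_pdivrMr //; lra.
rewrite ltr_pdivrMr //; move: n2; rewrite ltr_pdivrMr // mulrC.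
by apply: le_lt_trans; rewrite (le_trans (cm _ _ zK')) // ler_norm.
Qed.

Lemma norm_add_ge0 t : 0 <= `|t| + t.
Proof. by have := ler_norm (- t); rewrite normrN; lra. Qed.

(** [|t| + t] is twice the positive part of [t]: it dominates [t] and is monotone on the whole line,
    as [poly_approximable_of_rate] demands of a rate. *)
Lemma norm_add_homo : {homo (fun t => `|t| + t) : s t / s <= t}.
Proof.
move=> s t st; have [s0|s0] := leP 0 s; last first.
  by rewrite (ltr0_norm s0) addNr norm_add_ge0.
by rewrite !ger0_norm ?lerD //; lra.
Qed.

Lemma cexp_approximable : poly_approximable cexp.
Proof.
apply: (@poly_approximable_of_rate _ (fun t => 4 * (`|t| + t) ^+ 2 * expR t) (@cexp_poly R)).
  move=> n z n0 zn; rewrite (le_trans (cexp_poly_dist n0 zn)) //.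
  rewrite [leRHS]mulrAC ler_wpM2r ?expR_ge0 // ler_wpM2r ?invr_ge0 //.
  rewrite ler_wpM2l // lerXn2r ?nnegrE ?addr_ge0 ?cmod_ge0 //.
  by rewrite lerDr.
move=> s t st; rewrite -![4 * _ * _]mulrA ler_wpM2l // ler_pM ?ler_expR ?expR_ge0 ?sqr_ge0 //.
by rewrite lerXn2r ?nnegrE ?norm_add_ge0 ?norm_add_homo.
Qed.

Lemma sinhc_approximable : poly_approximable sinhc.
Proof.
apply: (@poly_approximable_of_rate _ (fun t => 4 * (`|t| + t) * expR t) (@sinhc_poly R)).
  move=> n z n0 zn; rewrite (le_trans (sinhc_poly_dist n0 zn)) //.
  rewrite [leRHS]mulrAC ler_wpM2r ?expR_ge0 // ler_wpM2r ?invr_ge0 //.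
  by rewrite ler_wpM2l // lerDr.
move=> s t st; rewrite -![4 * _ * _]mulrA ler_wpM2l // ler_pM ?ler_expR ?expR_ge0 //.
  exact: norm_add_ge0.
exact: norm_add_homo.
Qed.

Lemma poly_approximable_comp_affine f x y : poly_approximable f ->
  poly_approximable (fun z => f (x + y * z)).
Proof.
move=> Hf K e e0; have [p Hp] := Hf (cmod x + cmod y * K) e e0.
exists (p \Po (x%:P + y *: 'X)) => z zK.
rewrite horner_comp !hornerE Hp // (le_trans (cmod_le_add _ _)) // cmodM.
by rewrite lerD2l ler_wpM2l ?cmod_ge0.
Qed.

Lemma poly_approximable_bounded f K : poly_approximable f ->
  exists2 M, 0 <= M & forall z, cmod z <= K -> cmod (f z) <= M.
Proof.
move=> Hf; have [p Hp] := Hf K 1 ltr01.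
have [L L0 HL] := poly_lipschitz p (normr_ge0 K).
exists (1 + L) => [|z zK]; first by lra.
have zK' : cmod z <= `|K| := le_trans zK (ler_norm _).
have [pz _] := HL z z zK' zK'; have := Hp z zK.
by have := cmod_le_add (f z - p.[z]) p.[z]; rewrite subrK; lra.
Qed.

Lemma poly_approximable_continuous f y e : poly_approximable f -> 0 < e ->
  exists2 s, 0 < s & forall x, cmod (x - y) < s -> cmod (f x - f y) < e.
Proof.
move=> Hf e0; have e30 : 0 < e / 3 by lra.
have [p Hp] := Hf (cmod y + 1) _ e30.
have K0 : 0 <= cmod y + 1 by rewrite addr_ge0 ?cmod_ge0.
have [L L0 HL] := poly_lipschitz p K0.
exists (Num.min 1 (e / 3 / L)) => [|x]; first by rewrite lt_min ltr01 divr_gt0.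
rewrite lt_min ltr_pdivlMr // => /andP[xy1 xyL].
have xK : cmod x <= cmod y + 1.
  by have := cmod_dist y x 0; rewrite !subr0; lra.
have yK : cmod y <= cmod y + 1 by lra.
have [_] := HL x y xK yK; have := Hp x xK; have := Hp y yK.
rewrite mulrC (cmodB (f y)); have := cmod_dist p.[x] (f x) (f y).
by have := cmod_dist p.[y] p.[x] (f y); lra.
Qed.

Lemma poly_approximable_mul f g : poly_approximable f -> poly_approximable g ->
  poly_approximable (fun z => f z * g z).
Proof.
move=> Hf Hg K e e0.
have [M M0 HM] := poly_approximable_bounded K Hf.
have [N N0 HN] := poly_approximable_bounded K Hg.
pose d := e / (M + N + 1 + e).
have D0 : 0 < M + N + 1 + e by lra.
have d0 : 0 < d by rewrite divr_gt0.
have d1 : d <= 1 by rewrite /d ler_pdivrMr //; lra.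
have dE : d * (M + N + 1 + e) = e by rewrite /d divfK ?gt_eqF.
have [p Hp] := Hf K d d0; have [q Hq] := Hg K d d0.
exists (p * q) => z zK; rewrite hornerM.
have -> : f z * g z - p.[z] * q.[z] =
  (f z - p.[z]) * g z + p.[z] * (g z - q.[z]) by ring.
rewrite (le_lt_trans (cmod_le_add _ _)) // !cmodM.
have pM : cmod p.[z] <= M + 1.
  have := HM z zK; have := Hp z zK.
  by have := cmod_le_sub (f z) (f z - p.[z]); rewrite subKr; lra.
have h1 : cmod (f z - p.[z]) * cmod (g z) <= d * N.
  by apply: ler_pM; rewrite ?cmod_ge0 ?HN // ltW ?Hp.
have h2 : cmod p.[z] * cmod (g z - q.[z]) <= (M + 1) * d.
  by apply: ler_pM; rewrite ?cmod_ge0 // ltW ?Hq.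
have de : 0 < d * e by rewrite mulr_gt0.
by rewrite -[ltRHS]dE; lra.
Qed.

Lemma poly_approximable_const x : poly_approximable (fun=> x).
Proof. by move=> K e e0; exists x%:P => z _; rewrite hornerC subrr cmod0. Qed.

Lemma poly_approximable_biv (G : {poly {poly C}}) f q : poly_approximable f ->
  poly_approximable (fun z => G.[f z, q.[z]]).
Proof.
move=> Hf K e e0.
have [M M0 HM] := poly_approximable_bounded K Hf.
have [N N0 HN] := poly_lipschitz q (normr_ge0 K).
have K0 : 0 <= M + N + 1 by lra.
have [L L0 HL] := biv_lipschitz G K0.
pose d := Num.min 1 (e / L).
have d0 : 0 < d by rewrite lt_min ltr01 divr_gt0.
have d1 : d <= 1 by rewrite ge_min lexx.
have dL : L * d <= e by rewrite mulrC -ler_pdivlMr // ge_min lexx orbT.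
have [p Hp] := Hf K d d0; have [r Hr] := biv_subst_poly G p q.
exists r => z zK; rewrite -Hr.
have zK' : cmod z <= `|K| := le_trans zK (ler_norm _).
have [qz _] := HN z z zK' zK'.
have fz := HM z zK; have pz := Hp z zK.
have pz' : cmod p.[z] <= M + 1.
  by have := cmod_le_sub (f z) (f z - p.[z]); rewrite subKr; lra.
have [||||_ h] := HL (f z) p.[z] q.[z] q.[z];
  try by move: fz pz' qz M0 N0; clear; lra.
rewrite (le_lt_trans h) // subrr cmod0 addr0 (lt_le_trans _ dL) //.
by rewrite ltr_pM2l.
Qed.

(** A product of two segments, hence compact, lying between the closed discs of radius [s] and
    [2 * s]. *)
Definition square s : set C := [set z | `|complex.Re z| <= s /\ `|complex.Im z| <= s].

Lemma square_cmod s z : square s z -> cmod z <= 2 * s.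
Proof. by case=> a b; rewrite (le_trans (cmod_le_ReIm _)) //; lra. Qed.

Lemma cmod_square s z : cmod z <= s -> square s z.
Proof. by move=> zs; split; apply: le_trans zs; rewrite ?Re_le_cmod ?Im_le_cmod. Qed.

Lemma EVT_square f s : 0 <= s -> poly_approximable f ->
  exists2 z, square s z & forall w, square s w -> cmod (f z) <= cmod (f w).
Proof.
move=> s0 Hf; pose F (t : R * R) : R := cmod (f (t.1 +i* t.2)).
pose A : set (R * R) := `[- s, s] `*` `[- s, s].
have cA : compact A by apply: compact_setX; exact: segment_compact.
have A0 : A !=set0.
  by exists (0, 0); split=> /=; rewrite in_itv /= oppr_le0 s0.
have cF : continuous F.
  move=> [a b]; apply/cvgrPdist_lt => e e0.
  have [d d0 Hd] := poly_approximable_continuous (a +i* b) Hf e0.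
  have d20 : 0 < d / 2 by lra.
  exists (ball a (d / 2), ball b (d / 2)).
    by split; apply: nbhsx_ballx.
  move=> t [ta tb]; have {}ta : `|a - t.1| < d / 2 := ta.
  have {}tb : `|b - t.2| < d / 2 := tb.
  have /Hd : cmod (t.1 +i* t.2 - a +i* b) < d.
    rewrite (le_lt_trans (cmod_le_ReIm _)) //=.
    by rewrite -(distrC a) -(distrC b); lra.
  rewrite /F /= => h.
  have h1 := cmod_sub_ge (f (t.1 +i* t.2)) (f (a +i* b)).
  have h2 := cmod_sub_ge (f (a +i* b)) (f (t.1 +i* t.2)).
  rewrite (cmodB (f (a +i* b))) in h2.
  by rewrite ltr_norml; apply/andP; split; lra.
have [[a b] abA Hab] := compact_EVT_min A0 cA (continuous_subspaceT cF).
have AP (t1 t2 : R) : ((t1, t2) \in A) = (`|t1| <= s) && (`|t2| <= s).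
  by apply/idP/idP; rewrite inE /A /= !in_itv /= !ler_norml => /andP.
exists (a +i* b); first by move: abA; rewrite AP => /andP[].
move=> [t1 t2] [w1 w2]; apply: (Hab (t1, t2)).
by rewrite AP; apply/andP.
Qed.

(* Expanding [p (y + u) = p y + c u^k + ...] with [c != 0], move in a direction
   in which [c u^k] is a negative multiple of [p y]. *)
Lemma poly_min_modulus p y e : (1 < size p)%N -> p.[y] != 0 -> 0 < e ->
  exists2 x, cmod (x - y) < e & cmod p.[x] < cmod p.[y].
Proof.
move=> sp py e0; pose q := p \Po ('X + y%:P).
have qE u : q.[u] = p.[u + y] by rewrite horner_comp !hornerE.
pose q0 := q - p.[y]%:P.
have q0n : q0 != 0.
  rewrite subr_eq0; apply/eqP => qc.
  have sq : size q = size p by rewrite size_comp_poly2 // size_XaddC.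
  by move: sp; rewrite -sq qc ltnNge size_polyC leq_b1.
have [k [g g0 qg]] := multiplicity_XsubC q0 0; rewrite q0n /= in g0.
rewrite subr0 in qg; have {}g0 : g.[0] != 0 by rewrite -rootE.
have qE' u : p.[u + y] = p.[y] + g.[u] * u ^+ k.
  by rewrite -qE -hornerXn -hornerM -qg /q0 hornerD hornerN hornerC addrC subrK.
have k0 : (0 < k)%N.
  rewrite lt0n; apply/eqP => k0; have := qE' 0.
  by rewrite k0 add0r mulr1 => /eqP; rewrite -subr_eq0 opprD addNKr oppr_eq0 (negbTE g0).
have [v vE] : exists v : C, v ^+ k = - p.[y] / g.[0].
  (* The coefficient sequence has the single nonzero candidate in degree 0, so the equation solved
     is [v^k = - p(y) / g(0)]. *)
  have := @solve_monicpoly C k (nth 0 [:: - p.[y] / g.[0]]) k0.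
  move=> [v vE]; exists v; rewrite vE; case: k k0 {qg qE' vE} => // k _.
  rewrite big_ord_recl big1 ?addr0 ?expr0 ?mulr1 // => i _.
  by rewrite /= nth_nil mul0r.
have v0 : v != 0.
  apply: contra_neq py => v0; move: vE.
  rewrite v0 expr0n gtn_eqF // => /esym/eqP.
  by rewrite mulf_eq0 invr_eq0 (negbTE g0) orbF oppr_eq0 => /eqP.
have [L L0 HL] := poly_lipschitz g (cmod_ge0 v).
pose m := cmod p.[y]; have m0 : 0 < m by rewrite cmod_gt0.
have cv : 0 < cmod v by rewrite cmod_gt0.
pose B := L * cmod v * cmod v ^+ k.
have B0 : 0 < B by rewrite !mulr_gt0 ?exprn_gt0.
(* The three bounds give, in order, [|t v| <= |v|] and [t^k <= 1], a remainder of at most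
   [t^k * m / 2] against the gain [t^k * m], and a displacement below [e]. *)
pose t := Num.min (1 / 2) (Num.min (m / B / 2) (e / cmod v / 2)).
have t0 : 0 < t by rewrite !lt_min !divr_gt0.
have t1 : t <= 1 / 2 by rewrite ge_min lexx.
have tm : t <= m / B / 2 by rewrite !ge_min lexx orbT.
have te : t <= e / cmod v / 2 by rewrite !ge_min lexx !orbT.
have ctv : cmod (t%:C * v) = t * cmod v by rewrite cmodM cmod_real gtr0_norm.
exists (t%:C * v + y).
  rewrite addrK ctv; move: te; rewrite -mulrA -invfM ler_pdivlMr ?mulr_gt0 //.
  by have := mulr_gt0 t0 cv; lra.
have [||_ h] := HL (t%:C * v) 0.
- by rewrite ctv ler_piMl ?cmod_ge0 //; lra.
- by rewrite cmod0 cmod_ge0.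
rewrite qE'.
have -> : p.[y] + g.[t%:C * v] * (t%:C * v) ^+ k =
    p.[y] * (1 - t ^+ k)%:C + (g.[t%:C * v] - g.[0]) * (t%:C * v) ^+ k.
  rewrite mulrBl !exprMn; have -> : g.[0] * (t%:C ^+ k * v ^+ k) = - p.[y] * t%:C ^+ k.
    by rewrite vE mulrCA [g.[0] * _]mulrC mulfVK // mulrC.
  by rewrite rmorphB rmorphXn rmorph1; ring.
rewrite (le_lt_trans (cmod_le_add _ _)) // !cmodM cmodX ctv cmod_real -/m.
have tk0 : 0 < t ^+ k by rewrite exprn_gt0.
have tk1 : t ^+ k <= 1 by rewrite exprn_ile1 //; lra.
rewrite ger0_norm; last by lra.
rewrite subr0 ctv in h.
have h2 : cmod (g.[t%:C * v] - g.[0]) * (t * cmod v) ^+ k <= t ^+ k * (B * t).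
  rewrite (@le_trans _ _ (L * (t * cmod v) * (t * cmod v) ^+ k)) //.
    by rewrite ler_wpM2r ?exprn_ge0 ?mulr_ge0 ?cmod_ge0 // ltW.
  by rewrite exprMn /B le_eqVlt; apply/orP; left; apply/eqP; ring.
have h3 : B * t <= m / 2.
  rewrite mulrC; move: tm; rewrite -mulrA [B^-1 * _]mulrC mulrA ler_pdivlMr //.
have h4 : t ^+ k * (B * t) <= t ^+ k * (m / 2) by rewrite ler_pM2l.
have h5 : 0 < t ^+ k * m by rewrite mulr_gt0.
lra.
Qed.

(** The minimum of [|p|] over the square is below [m], hence attained inside the disc of radius [s],
    where a nonzero minimum contradicts [poly_min_modulus]. *)
Lemma poly_root_in_square p s m : 0 < s -> cmod p.[0] < m ->
  (forall z, square s z -> s <= cmod z -> m <= cmod p.[z]) ->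
  exists2 z, cmod z < s & p.[z] = 0.
Proof.
move=> s0 p0 ps.
have Hp : poly_approximable (horner p).
  by move=> K e e0; exists p => z _; rewrite subrr cmod0.
have [z sz zmin] := EVT_square (ltW s0) Hp.
have z0 : cmod p.[z] <= cmod p.[0].
  by apply: zmin; apply: cmod_square; rewrite cmod0 ltW.
have zs : cmod z < s.
  by rewrite ltNge; apply/negP => sz'; have := ps z sz sz'; lra.
exists z => //; apply/eqP; apply: contraT => pz.
have sp : (1 < size p)%N.
  rewrite ltnNge; apply/negP => /size1_polyC pc.
  have : m <= cmod p.[s%:C].
    have cs : cmod s%:C = s by rewrite cmod_real gtr0_norm.
    by apply: ps; rewrite ?cs //; apply: cmod_square; rewrite cs.
  by move: p0; rewrite pc !hornerC; lra.
have sz0 : 0 < s - cmod z by lra.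
have [x xz] := poly_min_modulus sp pz sz0.
rewrite ltNge zmin //; apply: cmod_square.
by have := cmod_dist z x 0; rewrite !subr0; lra.
Qed.

(** If the minimum [|f z|] were positive, a polynomial within [e <= |f z|] of [f] would still
    satisfy the hypotheses with [m - e]; at its root [|f|] would be less than [e], below the
    minimum. *)
Lemma zero_in_square f s m : 0 < s -> poly_approximable f -> cmod (f 0) < m ->
  (forall z, square s z -> s <= cmod z -> m <= cmod (f z)) ->
  exists2 z, cmod z < s & f z = 0.
Proof.
move=> s0 Hf f0 fs; have [z sz zmin] := EVT_square (ltW s0) Hf.
have z0 : cmod (f z) <= cmod (f 0).
  by apply: zmin; apply: cmod_square; rewrite cmod0 ltW.
have zs : cmod z < s.
  by rewrite ltNge; apply/negP => sz'; have := fs z sz sz'; lra.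
exists z => //; apply/eqP; apply: contraT => fz.
have cf : 0 < cmod (f z) by rewrite cmod_gt0.
pose e := Num.min (cmod (f z)) ((m - cmod (f 0)) / 2).
have e0 : 0 < e by rewrite lt_min cf /=; lra.
have ez : e <= cmod (f z) by rewrite ge_min lexx.
have em : e <= (m - cmod (f 0)) / 2 by rewrite ge_min lexx orbT.
have [p Hp] := Hf (2 * s) e e0.
have Hps w (sw : square s w) := Hp w (square_cmod sw).
have [|w sw ws|x xs px] := @poly_root_in_square p s (m - e) s0.
- have := Hp 0; rewrite cmod0 cmodB => /(_ _).
  have := cmod_sub_ge p.[0] (f 0).
  by move=> h /(_ ltac:(lra)); lra.
- have := fs w sw ws; have := Hps w sw; have := cmod_sub_ge (f w) (f w - p.[w]).
  by rewrite subKr; lra.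
have sx : square s x by apply/cmod_square/ltW.
by have := Hps x sx; have := zmin x sx; rewrite px subr0; lra.
Qed.

End ApproximationByPolynomials.

(** * Local factorization of [sinhc] at points of the imaginary axis *)

Section LocalFactor.
Context {R : realType}.
Local Notation C := (R[i]).
Implicit Types (f h : C -> C) (a l m z : C) (b k e rho : R).

(** Continuity at a nonzero value, in multiplicative form and for moduli only: stable under products
    and inverses, and suited to comparing logarithms of root moduli. *)
Definition slowly_varying a h := forall k, 0 < k ->
  exists2 e, 0 < e & forall l m, cmod (l - a) < e -> cmod (m - a) < e ->
    h l != 0 /\ cmod (h l) <= (1 + k) * cmod (h m).

Lemma slowly_varying_continuous a h : poly_approximable h -> h a != 0 ->
  slowly_varying a h.
Proof.
move=> Hh ha k k0; have ca : 0 < cmod (h a) by rewrite cmod_gt0.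
pose d := cmod (h a) * (Num.min 1 k / 4).
have k'0 : 0 < Num.min 1 k by rewrite lt_min ltr01.
have k'1 : Num.min 1 k <= 1 by rewrite ge_min lexx.
have k'k : Num.min 1 k <= k by rewrite ge_min lexx orbT.
have d0 : 0 < d by rewrite mulr_gt0 // divr_gt0.
have [e e0 He] := poly_approximable_continuous a Hh d0.
have hd l : cmod (l - a) < e -> cmod (h a) - d < cmod (h l) < cmod (h a) + d.
  move=> /He la; have h1 := cmod_sub_ge (h l) (h a).
  have h2 := cmod_sub_ge (h a) (h l); rewrite (cmodB (h a)) in h2.
  by apply/andP; split; lra.
have dE : 4 * d = cmod (h a) * Num.min 1 k by rewrite /d; field.
have d1 : 4 * d <= cmod (h a) by rewrite dE ler_piMr // ltW.
have dk : 4 * d <= cmod (h a) * k by rewrite dE ler_pM2l.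
exists e => // l m /hd/andP[l1 l2] /hd/andP[m1 m2]; split.
  by rewrite -cmod_gt0; lra.
have : k * (cmod (h a) / 2) <= k * cmod (h m) by rewrite ler_pM2l //; lra.
by rewrite mulrDl mul1r; lra.
Qed.

Lemma slowly_varying_mul a f h : slowly_varying a f -> slowly_varying a h ->
  slowly_varying a (fun z => f z * h z).
Proof.
move=> Hf Hh k k0; pose k' := Num.min 1 k / 3.
have k1 : Num.min 1 k <= 1 by rewrite ge_min lexx.
have kk : Num.min 1 k <= k by rewrite ge_min lexx orbT.
have k'0 : 0 < k' by rewrite divr_gt0 // lt_min ltr01.
have [e e0 He] := Hf k' k'0; have [d d0 Hd] := Hh k' k'0.
exists (Num.min e d) => [|l m]; first by rewrite lt_min e0.
rewrite !lt_min => /andP[le ld] /andP[me md].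
have [fl fm] := He l m le me; have [hl hm] := Hd l m ld md.
split; first by rewrite mulf_neq0.
rewrite !cmodM (le_trans (ler_pM (cmod_ge0 _) (cmod_ge0 _) fm hm)) //.
rewrite mulrACA ler_wpM2r ?mulr_ge0 ?cmod_ge0 //.
have kE : k' * 3 = Num.min 1 k by rewrite /k' divfK.
nra.
Qed.

Lemma slowly_varying_inv a h : slowly_varying a h ->
  slowly_varying a (fun z => (h z)^-1).
Proof.
move=> Hh k k0; have [e e0 He] := Hh k k0; exists e => // l m le me.
have [hl _] := He l m le me; have [hm hml] := He m l me le.
rewrite invr_eq0 !cmodV; split=> //.
have cl : 0 < cmod (h l) by rewrite cmod_gt0.
have cm : 0 < cmod (h m) by rewrite cmod_gt0.
by rewrite ler_pdivlMr // mulrC ler_pdivrMr.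
Qed.

(* A zero of [sinhc] on the imaginary axis is simple; the exponent [n] is [1]
   there and [0] elsewhere. *)
Lemma sinhc_local_factor rho b : 0 < rho ->
  exists n h, slowly_varying (0 +i* b) h /\
    exists2 e, 0 < e & forall l, cmod (l - 0 +i* b) < e ->
      sinhc (l * rho%:C) = (l - 0 +i* b) ^+ n * h l.
Proof.
move=> rho0; set ib : C := 0 +i* b.
have rn0 : rho%:C != 0 by rewrite -cmod_gt0 cmod_real normr_gt0 gt_eqF.
have [s0|s0] := eqVneq (sinhc (ib * rho%:C)) 0; last first.
  exists 0%N, (fun l => sinhc (0 + rho%:C * l)); split.
    apply: slowly_varying_continuous; last by rewrite add0r mulrC.
    exact/poly_approximable_comp_affine/sinhc_approximable.
  by exists 1 => // l _; rewrite expr0 mul1r add0r mulrC.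
have ib0 : ib != 0.
  apply: contra_eq_neq s0 => ->; rewrite mul0r /sinhc eqxx oner_neq0 //.
have ibr : ib * rho%:C = 0 +i* (b * rho) by rewrite /ib; simpc.
have sb : sin (b * rho) = 0.
  have b0 : b * rho != 0.
    apply: contraNneq ib0 => /eqP; rewrite mulf_eq0 (gt_eqF rho0) orbF => /eqP b0.
    by rewrite /ib b0.
  have := s0; rewrite ibr sinhc_imag /sinc (negbTE b0) => -[] /eqP.
  by rewrite mulf_eq0 invr_eq0 (negbTE b0) orbF => /eqP.
set c := (cos (b * rho))%:C.
have cn0 : c != 0.
  by rewrite -cmod_gt0 cmod_real sin0cos1.
have e1 : cexp (ib * rho%:C) = c by rewrite ibr cexp_imag sb.
have e2 : cexp (- (ib * rho%:C)) = c.
  have -> : - (ib * rho%:C) = 0 +i* (- (b * rho)) by rewrite ibr; simpc.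
  by rewrite cexp_imag sinN sb oppr0 cosN.
(* Since [exp (i b rho) = exp (- i b rho) = c], one has [sinh (l rho) = c * sinh ((l - i b) rho)];
   dividing by [l rho] leaves [l - i b] times this function. *)
exists 1%N, (fun l => c * sinhc (- (ib * rho%:C) + rho%:C * l) * l^-1); split.
  apply: slowly_varying_mul.
    apply: slowly_varying_continuous; last first.
      by rewrite [rho%:C * _]mulrC addNr /sinhc eqxx mulr1.
    apply: poly_approximable_mul; first exact: poly_approximable_const.
    exact/poly_approximable_comp_affine/sinhc_approximable.
  apply: slowly_varying_inv; apply: (@slowly_varying_continuous ib id) => //.
  by move=> K e e0; exists 'X => z _; rewrite hornerX subrr cmod0.
exists (cmod ib) => [|l lb]; first by rewrite cmod_gt0.
have l0 : l != 0.
  by apply: contraTneq lb => ->; rewrite sub0r cmodN ltxx.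
have [->|lib] := eqVneq l ib; first by rewrite s0 subrr expr0n mul0r.
have lr0 : l * rho%:C != 0 by rewrite mulf_neq0.
have wE : - (ib * rho%:C) + rho%:C * l = (l - ib) * rho%:C by ring.
have w0 : (l - ib) * rho%:C != 0 by rewrite mulf_neq0 // subr_eq0.
rewrite wE /sinhc (negbTE lr0) (negbTE w0) /csinh.
have {1}-> : l * rho%:C = (l - ib) * rho%:C + ib * rho%:C by ring.
have -> : - (l * rho%:C) = - ((l - ib) * rho%:C) - ib * rho%:C by ring.
rewrite !cexpD e1 e2 expr1; field.
by rewrite -subr_eq0 in lib; rewrite l0 rn0 lib.
Qed.

End LocalFactor.

(** * The determinant [det (l - A - x B)] as a bivariate polynomial *)

Section CharacteristicPolynomial.
Context {R : realType}.
Local Notation C := (R[i]).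
Local Notation toC M := (map_mx (real_complex R) M).

(** The unknown is the coefficient [x] of [B]; the parameter is the spectral variable [l]. *)
Definition biv_char n (A B : 'M[R]_n) : {poly {poly C}} :=
  \det (('X%:P)%:M - map_mx (polyC \o polyC) (toC A)
        - 'X *: map_mx (polyC \o polyC) (toC B)).

Lemma horner2_entry (a b x l : C) (k : nat) :
  ('X%:P *+ k - (a%:P)%:P - 'X * (b%:P)%:P : {poly {poly C}}).[x, l] =
  l *+ k - a - x * b.
Proof.
rewrite !hornerD !hornerN !hornerMn !hornerM !hornerC !hornerX.
by rewrite ?hornerMn ?hornerM ?hornerC ?hornerX.
Qed.

Lemma horner2_biv_char n (A B : 'M[R]_n) (x l : C) :
  (biv_char A B).[x, l] = \det (l%:M - toC A - x *: toC B).
Proof.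
rewrite -[_.[l]]/(horner_eval l _) -[_.[x%:P]]/(horner_eval x%:P _).
rewrite -!det_map_mx; congr (\det _); apply/matrixP => i j.
by rewrite !mxE /horner_eval; exact: horner2_entry.
Qed.

Lemma horner_char_poly n (M : 'M[C]_n) l : (char_poly M).[l] = \det (l%:M - M).
Proof.
rewrite -[_.[l]]/(horner_eval l _) -det_map_mx; congr (\det _); apply/matrixP => i j.
rewrite !mxE; transitivity ('X *+ (i == j) - (M i j)%:P).[l]; first by [].
by rewrite hornerD hornerN hornerC hornerMn hornerX.
Qed.

Lemma polyP_horner (p q : {poly C}) : (forall x, x != 0 -> p.[x] = q.[x]) -> p = q.
Proof.
move=> pq; apply/eqP; rewrite -subr_eq0; apply/eqP/poly_eq0_punctured => x x0.
by rewrite hornerD hornerN pq // subrr.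
Qed.

Lemma biv_char_coef0 n (A B : 'M[R]_n) : (biv_char A B)`_0 = char_poly (toC A).
Proof.
apply: polyP_horner => l _.
by rewrite -horner2_0 horner2_biv_char horner_char_poly scale0r subr0.
Qed.

Variables (m d : nat) (A1 : 'M[R]_m) (A2 : 'M[R]_(m, d)) (A3 : 'M[R]_(d, m)).
Variables (A4 D : 'M[R]_d).
Let P := biv_char (block_mx A1 A2 A3 A4) (block_mx 0 0 0 D).

Lemma size_linear_le (u v : {poly C}) : (size (u%:P - 'X * v%:P)%R <= (v != 0%R).+1)%N.
Proof.
have [->|v0] := eqVneq v 0; first by rewrite mulr0 subr0 size_polyC_leq1.
rewrite (leq_trans (size_polyD _ _)) // geq_max.
rewrite (leq_trans (size_polyC_leq1 _)) //= size_polyN.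
by rewrite (leq_trans (size_polyMleq _ _)) // size_polyX size_polyC v0.
Qed.

(** In the Leibniz expansion the first [m] rows contribute factors constant in [x], since [B]
    vanishes there, and the last [d] rows factors of degree at most 1. *)
Lemma size_biv_char_block : (size P <= d.+1)%N.
Proof.
rewrite /P /biv_char; set B := map_mx _ (toC (block_mx 0 0 0 D)); set M := (X in \det X).
have sM i j : (size (M i j) <= (toC (block_mx 0 0 0 D) i j != 0%R).+1)%N.
  rewrite -(polyC_eq0 (toC _ i j)) /M /B !mxE -polyCMn -polyCB.
  exact: size_linear_le.
have sT (i : 'I_m) j : (size (M (lshift d i) j) <= 1)%N.
  by rewrite (leq_trans (sM _ _)) // mxE col_mxEu row_mx0 mxE eqxx.
have sB i j : (size (M i j) <= 2)%N.
  by rewrite (leq_trans (sM _ _)) //; case: (_ != _).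
apply: (leq_trans (size_sum _ _ _)); apply/bigmax_leqP => s _.
rewrite size_Msign (leq_trans (size_poly_prod_leq _ _)) //.
have -> : #|[pred i : 'I_(m + d) | true]| = (m + d)%N by rewrite -[RHS]card_ord.
rewrite leq_subLR big_split_ord /=.
have h1 (g : 'I_(m + d) -> 'I_(m + d)) :
    (\sum_(i < m) size (M (lshift d i) (g (lshift d i))) <= m)%N.
  apply: (@leq_trans (\sum_(i < m) 1)); first exact: leq_sum.
  by rewrite sum_nat_const card_ord muln1.
have h2 (g : 'I_(m + d) -> 'I_(m + d)) :
    (\sum_(i < d) size (M (rshift m i) (g (rshift m i))) <= d * 2)%N.
  apply: (@leq_trans (\sum_(i < d) 2)); first exact: leq_sum.
  by rewrite sum_nat_const card_ord.
rewrite addnS ltnS -addnA; apply: leq_trans (leq_add (h1 _) (h2 _)) _.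
by rewrite leq_add2l muln2 addnn.
Qed.

(** At [x = 1 / w], multiplying the last [d] rows by [w] gives the matrix [N], polynomial in [w],
    whose determinant is the reversed polynomial. At [w = 0] it is block triangular with diagonal
    blocks [l - A1] and [- D]. *)
Lemma biv_char_coef_lead :
  P`_d = (\det (- toC D)) *: char_poly (toC A1).
Proof.
apply: polyP_horner => l _; rewrite -rev_poly_coef0 -horner2_0.
pose N : 'M[{poly C}]_(m + d) := block_mx (map_mx polyC (l%:M - toC A1))
  (map_mx polyC (- toC A2)) ('X *: map_mx polyC (- toC A3))
  ('X *: map_mx polyC (l%:M - toC A4) - map_mx polyC (toC D)).
have NE w : map_mx (horner_eval w) N = block_mx (l%:M - toC A1) (- toC A2)
    (w *: (- toC A3)) (w *: (l%:M - toC A4) - toC D).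
  rewrite map_block_mx; congr block_mx; apply/matrixP => i j; rewrite !mxE.
  - exact: hornerC.
  - exact: hornerC.
  - transitivity ('X * (- (A3 i j)%:C)%:P).[w]; first by [].
    by rewrite hornerM hornerX hornerC.
  - transitivity ('X * (l *+ (i == j) - (A4 i j)%:C)%:P - (D i j)%:C%:P).[w]; first by [].
    by rewrite hornerD hornerN hornerM hornerX !hornerC.
have detN w : (\det N).[w] = \det (block_mx (l%:M - toC A1) (- toC A2)
    (w *: (- toC A3)) (w *: (l%:M - toC A4) - toC D)).
  by rewrite -NE det_map_mx.
have -> : (rev_poly d P).[0, l] = (\det N).[0].
  rewrite -horner_at_param; congr (_.[_]); apply: polyP_horner => w w0.
  have := horner2_rev l size_biv_char_block (invr_neq0 w0).
  rewrite invrK horner2_biv_char horner_at_param => H.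
  apply: (@mulfI _ (w^-1 ^+ d)); first by rewrite expf_neq0 ?invr_neq0.
  rewrite -H detN !map_block_mx (@scalar_mx_block _ m d l) opp_block_mx add_block_mx.
  rewrite scale_block_mx opp_block_mx add_block_mx.
  rewrite !map_mx0 !scaler0 !subr0 !sub0r.
  have <- : \det (block_mx 1%:M 0 0 (w^-1)%:M : 'M[C]_(m + d)) = w^-1 ^+ d.
    by rewrite det_ublock det1 mul1r det_scalar.
  rewrite -det_mulmx mulmx_block !mul0mx !mul1mx !addr0 !add0r !mul_scalar_mx.
  by rewrite scalerBr !scalerA (mulVf w0) !scale1r.
by rewrite detN !scale0r sub0r det_ublock hornerZ horner_char_poly mulrC.
Qed.

End CharacteristicPolynomial.

(** * Confinement of the pseudo-continuous spectrum to a strip around the axis *)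

Section Confinement.
Context {R : realType}.
Local Notation C := (R[i]).
Local Notation toC M := (map_mx (real_complex R) M).

(** The product equals [c' * expR (- (a * (e^-1 - M)))], which is below [k] for all [a >= delta]
    once [e^-1 - M] exceeds [c' / (k * delta)]. Uniformity in [a] matters because [Re l] is not
    bounded. *)
Lemma exp_decay (c M S delta k : R) : 0 < c -> 0 <= M -> 0 < delta -> 0 < k ->
  exists2 e0, 0 < e0 & forall e a, 0 < e < e0 -> delta <= a ->
    c * expR (M * (a + S)) * expR (- (a / e)) < k.
Proof.
move=> c0 M0 delta0 k0; pose c' := c * expR (M * S).
have c'0 : 0 < c' by rewrite mulr_gt0 ?expR_gt0.
pose T := M + c' / (k * delta).
have q0 : 0 < c' / (k * delta) by rewrite divr_gt0 // mulr_gt0.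
have T0 : 0 < T by rewrite /T; lra.
exists T^-1 => [|e a /andP[e0 eT] da]; first by rewrite invr_gt0.
have Te : T < e^-1 by rewrite -[T]invrK ltf_pV2 ?posrE ?invr_gt0.
have -> : c * expR (M * (a + S)) * expR (- (a / e)) = c' * expR (- (a * (e^-1 - M))).
  by rewrite /c' -!mulrA -!expRD; congr (_ * expR _); ring.
have qE : delta * (c' / (k * delta)) = c' / k by field; rewrite !gt_eqF.
have h : c' / k < a * (e^-1 - M).
  rewrite -qE (@lt_le_trans _ _ (delta * (e^-1 - M))) //.
    by rewrite ltr_pM2l //; move: Te; rewrite /T; lra.
  by rewrite ler_wpM2r //; move: Te; rewrite /T; lra.
rewrite expRN ltr_pdivrMr ?expR_gt0 // -ltr_pdivrMl // mulrC.
by have := expR_ge1Dx (a * (e^-1 - M)); lra.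
Qed.

Variables (m d : nat) (rho : R) (A1 : 'M[R]_m) (A2 : 'M[R]_(m, d)).
Variables (A3 : 'M[R]_(d, m)) (A4 D : 'M[R]_d).
Hypotheses (rho0 : 0 < rho) (Du : D \in unitmx).
Let A := block_mx A1 A2 A3 A4.
Let B : 'M[R]_(m + d) := block_mx 0 0 0 D.
Let P := biv_char A B.

Lemma char_fun_biv eps l : char_fun rho A B eps l =
  P.[cexp (- (l / eps%:C)) * sinhc (l * rho%:C), l].
Proof. by rewrite horner2_biv_char. Qed.

Lemma p_omega_biv w x : p_omega rho A B w x =
  P.[x * sinhc ((0 +i* w) * rho%:C), 0 +i* w].
Proof.
have -> : (0 +i* w) * rho%:C = 0 +i* (rho * w) by simpc; rewrite mulrC.
by rewrite sinhc_imag horner2_biv_char.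
Qed.

Lemma mx_spectrum_root n (M : 'M[R]_n) l :
  mx_spectrum M l <-> root (char_poly (toC M)) l.
Proof. by rewrite /mx_spectrum /= eigenvalue_root_char. Qed.

Lemma const_coef_neq0 : P`_0 != 0.
Proof. by rewrite biv_char_coef0 monic_neq0 // char_poly_monic. Qed.

Lemma det_lead_neq0 : \det (- toC D) != 0.
Proof.
rewrite -scaleN1r detZ mulf_neq0 ?expf_neq0 ?oppr_eq0 ?oner_eq0 //.
by rewrite det_map_mx fmorph_eq0 -unitfE -unitmxE.
Qed.

Lemma lead_coef_neq0 : P`_d != 0.
Proof.
by rewrite biv_char_coef_lead scaler_eq0 negb_or det_lead_neq0 monic_neq0 // char_poly_monic.
Qed.

Lemma asym_plus_root l : root P`_0 l -> 0 < complex.Re l -> asym_plus A l.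
Proof. by rewrite biv_char_coef0 => rl l0; split=> //; apply/mx_spectrum_root. Qed.

Lemma asym_minus_root l : root P`_d l -> complex.Re l < 0 -> asym_minus A l.
Proof.
rewrite biv_char_coef_lead rootZ ?det_lead_neq0 // => rl l0.
by split=> //; rewrite block_mxKul; apply/mx_spectrum_root.
Qed.

Lemma pseudo_continuous_Re_small Rb delta :
  0 < delta -> (delta%:E <= sep_radius A)%E ->
  exists2 eps0, 0 < eps0 & forall eps l, 0 < eps < eps0 ->
    pseudo_continuous rho A B eps l -> `|complex.Im l| < Rb ->
    `|complex.Re l| < delta.
Proof.
move=> delta0 deltar.
have sP : (size P <= d.+1)%N := size_biv_char_block _ _ _ _ _.
have [k k0 Hk] := near_root const_coef_neq0 delta0.
have [k' k'0 Hk'] := near_root lead_coef_neq0 delta0.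
have [c [N [c0 Hc]]] := const_coef_le_at_root P.
have [c' [N' [c'0 Hc']]] := const_coef_le_at_root (rev_poly d P).
have c10 : 0 <= c + 1 by lra.
have c11 : 1 <= c + 1 by lra.
have c'10 : 0 <= c' + 1 by lra.
have c'11 : 1 <= c' + 1 by lra.
have kk0 : 0 < Num.min 1 k by rewrite lt_min ltr01.
have kk'0 : 0 < Num.min 1 k' by rewrite lt_min ltr01.
(* The constants [3] and [rho] come from the growth bound of [sinhc]. With [c + 1] for [c] the
   factor multiplying [|x|] is at least 1, so the same estimate also gives [|x| <= 1]. *)
have [e1 e10 H1] := @exp_decay (3 * (c + 1)) (N%:R + rho) Rb delta _
  ltac:(lra) ltac:(by rewrite addr_ge0 // ltW) delta0 kk0.
(* Here [2 / delta] and the exponent [1] come from [1 / |sinhc (l rho)| <= 2 |l| / |Re l| <= (2 /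
   delta) expR |l|]. *)
have [e2 e20 H2] := @exp_decay (2 / delta * (c' + 1)) (N'%:R + 1) Rb delta _
  ltac:(by rewrite !mulr_gt0 ?invr_gt0 //; lra) ltac:(by rewrite addr_ge0) delta0 kk'0.
exists (Num.min e1 e2) => [|eps l]; first by rewrite lt_min e10.
rewrite lt_min => /andP[eps0 /andP[eps1 eps2]] [sl ns] Il.
rewrite ltNge; apply/negP => Rl; apply: ns; left.
have la : cmod l <= `|complex.Re l| + Rb.
  by rewrite (le_trans (cmod_le_ReIm _)) // lerD2l ltW.
set a := `|complex.Re l| in Rl la.
have := sl; rewrite /spectrum /= char_fun_biv; set x := _ * sinhc _ => Px.
have Rle : complex.Re (- (l / eps%:C)) = - (complex.Re l / eps).
  have -> : l / eps%:C = l * (eps^-1)%:C by rewrite fmorphV.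
  by case: (l) => u v; rewrite /= !mulr0 subr0.
have cx : cmod x = expR (- (complex.Re l / eps)) * cmod (sinhc (l * rho%:C)).
  by rewrite cmodM cmod_cexp Rle.
have clr : cmod (l * rho%:C) = rho * cmod l.
  by rewrite cmodM cmod_real gtr0_norm // mulrC.
have [l0|l0] := leP 0 (complex.Re l).
  have aE : a = complex.Re l by rewrite /a ger0_norm.
  have h : cmod x <= expR (- (a / eps)) * (3 * expR (rho * cmod l)).
    by rewrite cx aE ler_wpM2l ?expR_ge0 // -clr cmod_sinhc_le.
  have Q := H1 eps a (introT andP (conj eps0 eps1)) Rl.
  have Nl : expR (N%:R * cmod l) * expR (rho * cmod l) <= expR ((N%:R + rho) * (a + Rb)).
    rewrite -expRD ler_expR -mulrDl ler_wpM2l // addr_ge0 // ltW //.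
  have eN1 : 1 <= expR (N%:R * cmod l) by rewrite -expR0 ler_expR mulr_ge0 ?cmod_ge0.
  have Q' : cmod x * ((c + 1) * expR (N%:R * cmod l)) < Num.min 1 k.
    apply: le_lt_trans Q.
    apply: (@le_trans _ _ (expR (- (a / eps)) * (3 * expR (rho * cmod l)) *
      ((c + 1) * expR (N%:R * cmod l)))).
      by rewrite ler_wpM2r // mulr_ge0 ?expR_ge0.
    have -> : expR (- (a / eps)) * (3 * expR (rho * cmod l)) *
      ((c + 1) * expR (N%:R * cmod l)) = 3 * (c + 1) *
      (expR (N%:R * cmod l) * expR (rho * cmod l)) * expR (- (a / eps)) by ring.
    by rewrite ler_wpM2r ?expR_ge0 // ler_wpM2l // mulr_ge0.
  have x1 : cmod x <= 1.
    apply: (@le_trans _ _ (cmod x * ((c + 1) * expR (N%:R * cmod l)))).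
      by rewrite ler_peMr ?cmod_ge0 // mulr_ege1.
    by rewrite ltW // (lt_le_trans Q') // ge_min lexx.
  have [|u ru lu] := Hk l.
    have kk : Num.min 1 k <= k by rewrite ge_min lexx orbT.
    apply: le_lt_trans (Hc x l x1 Px) _; apply: lt_le_trans kk; apply: le_lt_trans Q'.
    by rewrite ler_wpM2l ?cmod_ge0 // ler_wpM2r ?expR_ge0 // lerDl.
  left; split=> //; exists u; last by rewrite (lt_le_trans _ deltar) // lte_fin.
  (* Since [|l - u| < delta <= Re l], the root [u] has positive real part. *)
  apply: asym_plus_root => //.
  have := Re_le_cmod (l - u); rewrite ReB -aE; have := ler_norm (a - complex.Re u).
  by move: lu Rl; clear - P rho0 Du; lra.
have aE : a = - complex.Re l by rewrite /a ltr0_norm.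
have a0 : 0 < a by rewrite aE oppr_gt0.
have hs : a <= 2 * cmod l * cmod (sinhc (l * rho%:C)).
  have := cmod_sinhc_ge (l * rho%:C); rewrite clr.
  have -> : complex.Re (l * rho%:C) = rho * complex.Re l.
    by case: (l) => u v; rewrite /= !mulr0 subr0 mulrC.
  rewrite normrM (gtr0_norm rho0) -/a => h; rewrite -(ler_pM2l rho0).
  by apply: le_trans h _; rewrite le_eqVlt; apply/orP; left; apply/eqP; ring.
have sh0 : 0 < cmod (sinhc (l * rho%:C)).
  rewrite lt_def cmod_ge0 andbT; apply/eqP => s0.
  by move: hs; rewrite s0 mulr0 leNgt a0.
have x0 : x != 0.
  by rewrite -cmod_gt0 cx mulr_gt0 ?expR_gt0.
have Px' : (rev_poly d P).[x^-1, l] = 0.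
  have /eqP := Px; rewrite (horner2_rev _ sP x0) mulf_eq0 expf_eq0 (negbTE x0) andbF.
  by move/eqP.
have cxV : cmod x^-1 <= expR (- (a / eps)) * (2 / delta * expR (cmod l)).
  rewrite cmodV cx invfM -expRN opprK aE mulNr opprK ler_wpM2l ?expR_ge0 //.
  rewrite -[leLHS]mul1r ler_pdivrMr //.
  rewrite -(ler_pM2l delta0) mulr1.
  have el : cmod l <= expR (cmod l) 
    by apply: le_trans (expR_ge1Dx _); rewrite lerDr ler01.
  have -> : delta * (2 / delta * expR (cmod l) * cmod (sinhc (l * rho%:C))) =
    2 * expR (cmod l) * cmod (sinhc (l * rho%:C)) by field; rewrite gt_eqF.
  rewrite (le_trans Rl) // (le_trans hs) // ler_wpM2r ?cmod_ge0 // ler_wpM2l //.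
have Q := H2 eps a (introT andP (conj eps0 eps2)) Rl.
have Nl : expR (N'%:R * cmod l) * expR (cmod l) <= expR ((N'%:R + 1) * (a + Rb)).
  rewrite -expRD ler_expR -[X in _ + X]mul1r -mulrDl ler_wpM2l // addr_ge0 //.
have eN1 : 1 <= expR (N'%:R * cmod l) by rewrite -expR0 ler_expR mulr_ge0 ?cmod_ge0.
have dd0 : 0 < 2 / delta by rewrite divr_gt0.
have Q' : cmod x^-1 * ((c' + 1) * expR (N'%:R * cmod l)) < Num.min 1 k'.
  apply: le_lt_trans Q.
  apply: (@le_trans _ _ (expR (- (a / eps)) * (2 / delta * expR (cmod l)) *
    ((c' + 1) * expR (N'%:R * cmod l)))).
    by rewrite ler_wpM2r // mulr_ge0 ?expR_ge0.
  have -> : expR (- (a / eps)) * (2 / delta * expR (cmod l)) *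
    ((c' + 1) * expR (N'%:R * cmod l)) = 2 / delta * (c' + 1) *
    (expR (N'%:R * cmod l) * expR (cmod l)) * expR (- (a / eps)) by ring.
  by rewrite ler_wpM2r ?expR_ge0 // ler_wpM2l // mulr_ge0 // ltW.
have x1 : cmod x^-1 <= 1.
  apply: (@le_trans _ _ (cmod x^-1 * ((c' + 1) * expR (N'%:R * cmod l)))).
    by rewrite ler_peMr ?cmod_ge0 // mulr_ege1.
  by rewrite ltW // (lt_le_trans Q') // ge_min lexx.
have [|u ru lu] := Hk' l.
  have kk : Num.min 1 k' <= k' by rewrite ge_min lexx orbT.
  rewrite -rev_poly_coef0.
  apply: le_lt_trans (Hc' _ l x1 Px') _; apply: lt_le_trans kk; apply: le_lt_trans Q'.
  by rewrite ler_wpM2l ?cmod_ge0 // ler_wpM2r ?expR_ge0 // lerDl.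
right; split=> //; exists u; last by rewrite (lt_le_trans _ deltar) // lte_fin.
apply: asym_minus_root => //.
have := Re_le_cmod (l - u); rewrite ReB.
have := ler_norm (- (complex.Re l - complex.Re u)); rewrite normrN.
by move: aE lu Rl; clear - P rho0 Du; lra.
Qed.

End Confinement.

(** * Local form of the characteristic equation near the axis *)

Section LocalForm.
Context {R : realType}.
Local Notation C := (R[i]).

Definition scale_poly n (c : {poly C}) (G : {poly {poly C}}) : {poly {poly C}} :=
  \poly_(k < n.+1) (G`_k * c ^+ k).

Lemma horner2_scale n c (G : {poly {poly C}}) (z l : C) : (size G <= n.+1)%N ->
  (scale_poly n c G).[z, l] = G.[c.[l] * z, l].
Proof.
move=> sG; rewrite -!horner_at_param.
have sp : (size (at_param l G) <= n.+1)%N := leq_trans (size_at_param _ _) sG.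
have sr : (size (at_param l (scale_poly n c G)) <= n.+1)%N.
  by rewrite (leq_trans (size_at_param _ _)) // size_poly.
rewrite (horner_coef_wide _ sp) (horner_coef_wide _ sr); apply: eq_bigr => k _.
rewrite !coef_map coef_poly ltn_ord exprMn mulrA.
by rewrite /= /horner_eval hornerM horner_exp.
Qed.

(** The zero of [sinhc] is absorbed by scaling the unknown by [(l - i b)^k], and the common power
    [(l - i b)^j] is then divided out. Both operations change the extreme coefficients only by
    powers of [l - i b], so they stay nonzero, as [roots_on_axis] requires. *)
Lemma biv_local_form n (G : {poly {poly C}}) (rho b : R) :
  0 < rho -> (size G <= n.+1)%N -> G`_0 != 0 -> G`_n != 0 ->
  exists (j : nat) (H : {poly {poly C}}) (h : C -> C), [/\ (size H <= n.+1)%N, H`_0 != 0, H`_n != 0,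
      at_param (0 +i* b) H != 0 & slowly_varying (0 +i* b) h] /\
    exists2 e, 0 < e & forall l y, cmod (l - 0 +i* b) < e ->
      G.[y * sinhc (l * rho%:C), l] = (l - 0 +i* b) ^+ j * H.[h l * y, l].
Proof.
move=> rho0 sG G0 Gn; set ib : C := 0 +i* b.
have [k [h [hsv [e e0 he]]]] := sinhc_local_factor b rho0.
pose c := ('X - ib%:P) ^+ k; pose F := scale_poly n c G.
have c0 : c != 0 by rewrite expf_neq0 // polyXsubC_eq0.
have Fk i : (i <= n)%N -> F`_i = G`_i * c ^+ i by move=> i_n; rewrite coef_poly ltnS i_n.
have F0 : F != 0.
  by apply: contraNneq G0 => F0; have := Fk 0%N (leq0n _); rewrite F0 coef0 expr0 mulr1 => <-.
have [j [H FH Hb]] := biv_factor_param ib F0.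
have cj0 : ('X - ib%:P) ^+ j != 0 by rewrite expf_neq0 // polyXsubC_eq0.
have Hi i : (i <= n)%N -> G`_i != 0 -> H`_i != 0.
  move=> i_n; apply: contraNneq => Hi0; have := Fk i i_n.
  rewrite FH coefCM Hi0 mulr0 => /esym/eqP.
  by rewrite mulf_eq0 expf_eq0 (negbTE c0) andbF orbF.
exists j, H, h; split.
  split=> //; [|exact: Hi|exact: Hi].
  by rewrite -(size_Cmul _ cj0) -FH size_poly.
exists e => // l y lb; rewrite he // -/ib.
have -> : y * ((l - ib) ^+ k * h l) = c.[l] * (h l * y).
  by rewrite horner_exp hornerXsubC; ring.
by rewrite -(horner2_scale _ _ _ sG) -/F FH !hornerM !hornerC horner_exp hornerXsubC.
Qed.

End LocalForm.

(** * Closeness of the rescaled spectrum to the asymptotic continuous spectrum *)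

Section Accumulation.
Context {R : realType}.
Local Notation C := (R[i]).
Variables (m d : nat) (rho : R) (A1 : 'M[R]_m) (A2 : 'M[R]_(m, d)).
Variables (A3 : 'M[R]_(d, m)) (A4 D : 'M[R]_d).
Hypotheses (rho0 : 0 < rho) (Du : D \in unitmx).
Let A := block_mx A1 A2 A3 A4.
Let B : 'M[R]_(m + d) := block_mx 0 0 0 D.
Let P := biv_char A B.

Lemma strong_critical_of_p_omega w :
  (forall x, p_omega rho A B w x = 0) -> strong_critical rho A B (0 +i* w).
Proof.
move=> pw; exists w; split=> //; apply/mx_spectrum_root.
rewrite -(biv_char_coef0 A B) rootE -horner2_0 -/P; apply/eqP.
by have := pw 0; rewrite p_omega_biv // mul0r.
Qed.

(** Places the strong critical spectrum among finitely many points, which a small shift along the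
    axis avoids. *)
Lemma strong_critical_root z : strong_critical rho A B z -> root P`_0 z.
Proof.
by move=> [w [-> /mx_spectrum_root]]; rewrite biv_char_coef0.
Qed.

Lemma asym_continuous_of_root w y : y != 0 -> ~ strong_critical rho A B (0 +i* w) ->
  p_omega rho A B w y = 0 -> asym_continuous rho A B ((- ln (cmod y)) +i* w).
Proof.
move=> y0 nw py; apply: subset_closure; exists (- ln (cmod y)), w; split=> //.
by have [phi yE] := cexp_polar y0; exists phi; rewrite -yE.
Qed.

Lemma ln_ratio (s t k : R) : 0 < s -> 0 < t -> 0 < k -> s <= (1 + k) * ((1 + k) * t) ->
  ln s - ln t <= 2 * k.
Proof.
move=> s0 t0 k0 st; have k1 : 0 < 1 + k by lra.
have : ln s <= ln ((1 + k) * ((1 + k) * t)).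
  by rewrite ler_ln // posrE !mulr_gt0.
rewrite !lnM ?posrE ?mulr_gt0 //; have := @le_ln1Dx R k; lra.
Qed.

(** With [y = exp (- l / eps)], [h l * y] is a root of [H] at [l]; [roots_on_axis] yields a root [z]
    at some [i w], and [z / h (i w)] is a root of [p_omega] at [w]. Its modulus is close to [|y|] in
    ratio, and [ln |y| = - Re l / eps], so taking logarithms compares the rescaled real parts. *)
Lemma pseudo_continuous_local b delta : 0 < delta ->
  exists2 e, 0 < e & forall eps l, 0 < eps -> cmod (l - 0 +i* b) < e ->
    pseudo_continuous rho A B eps l ->
    exists2 mu, asym_continuous rho A B mu & cmod (rescale eps l - mu) < delta.
Proof.
move=> delta0; set ib : C := 0 +i* b.
have sP : (size P <= d.+1)%N by exact: size_biv_char_block.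
have P0 : P`_0 != 0 by exact: const_coef_neq0.
have Pd : P`_d != 0 by exact: lead_coef_neq0.
have [j [H [h [[sH H0 Hd Hb hsv] [e1 e10 HP]]]]] := biv_local_form b rho0 sP P0 Pd.
(* Two factors of at most [1 + delta / 8] cost at most [delta / 4] in the logarithm, and two shifts
   of at most [delta / 8] along the axis another [delta / 4]. *)
have k0 : 0 < Num.min 1 (delta / 8) by rewrite lt_min ltr01 divr_gt0.
have k10 : 0 <= 1 + Num.min 1 (delta / 8) by rewrite addr_ge0 // ltW.
have [e2 e20 Hh] := hsv _ k0.
have [e3 e30 Hc] := isolated_roots ib P0.
pose k := Num.min (Num.min 1 (delta / 8)) (Num.min e1 (Num.min e2 e3)).
have kpos : 0 < k by rewrite lt_min k0 !lt_min e10 e20.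
have kd : k <= delta / 8 by rewrite !ge_min lexx !orbT.
have kk : k <= Num.min 1 (delta / 8) by rewrite ge_min lexx.
have ke1 : k <= e1 by rewrite /k !ge_min lexx !orbT.
have ke2 : k <= e2 by rewrite /k !ge_min lexx !orbT.
have ke3 : k <= e3 by rewrite /k !ge_min lexx !orbT.
have [e4 e40 Hr] := roots_on_axis sH H0 Hd Hb kpos.
exists (Num.min k e4) => [|eps l eps0]; first by rewrite lt_min kpos.
rewrite lt_min => /andP[lk l4] [sl ns].
have l1 := lt_le_trans lk ke1; have l2 := lt_le_trans lk ke2.
pose y := cexp (- (l / eps%:C)).
have Hl : H.[h l * y, l] = 0.
  have := sl; rewrite /spectrum /= char_fun_biv HP // => /eqP.
  rewrite mulf_eq0 => /orP[lj|/eqP //].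
  (* If [(l - i b)^j] vanishes, then [l = i b] and [j > 0], so [p_omega] is identically zero at [b]
     and [l] is strong critical, which is excluded. *)
  case: ns; right; move: lj; rewrite expf_eq0 subr_eq0 => /andP[j0 /eqP ->].
  apply: strong_critical_of_p_omega => x.
  by rewrite p_omega_biv HP subrr ?cmod0 // expr0n (gtn_eqF j0) mul0r.
have [hl _] := Hh l l l2 l2.
have y0 : y != 0 := cexp_neq0 _.
have [w [z [wb z0 Hz zz1 zz2]]] := Hr l (h l * y) l4 (mulf_neq0 hl y0) Hl.
have {wb} [wb0 wb] := andP wb.
have iwb : cmod (0 +i* w - ib) = `|w - b| by rewrite cmod_imag_sub.
have iwk : cmod (0 +i* w - ib) < k by rewrite iwb.
have iw1 := lt_le_trans iwk ke1; have iw2 := lt_le_trans iwk ke2.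
have [hw hlw] := Hh (0 +i* w) l iw2 l2.
have [_ hwl] := Hh l (0 +i* w) l2 iw2.
have hz : h (0 +i* w) * (z / h (0 +i* w)) = z by rewrite mulrCA divff // mulr1.
have y'0 : z / h (0 +i* w) != 0 by rewrite mulf_neq0 // invr_eq0.
have cw : 0 < cmod (h (0 +i* w)) by rewrite cmod_gt0.
have cl : 0 < cmod (h l) by rewrite cmod_gt0.
have cy : 0 < cmod y by rewrite cmod_gt0.
have cz : 0 < cmod z by rewrite cmod_gt0.
exists ((- ln (cmod (z / h (0 +i* w)))) +i* w).
  apply: (asym_continuous_of_root y'0).
    (* [w] differs from [b] and lies within the isolation radius [e3], so [i w] is not a root of the
       constant coefficient. *)
    move=> /strong_critical_root; apply/negP/Hc.
    by rewrite iwb wb0 (lt_le_trans wb).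
  by rewrite p_omega_biv (HP _ _ iw1) hz Hz mulr0.
have lny : ln (cmod y) = - (complex.Re l / eps).
  rewrite cmod_cexp expRK.
  have -> : l / eps%:C = l * (eps^-1)%:C by rewrite fmorphV.
  by case: (l) => u v; rewrite /= !mulr0 subr0.
apply: (le_lt_trans (cmod_le_ReIm _)); rewrite ReB ImB /= opprK.
have zy1 : cmod (z / h (0 +i* w)) <= (1 + Num.min 1 (delta / 8)) *
    ((1 + Num.min 1 (delta / 8)) * cmod y).
  rewrite cmodM cmodV ler_pdivrMr //.
  have t1 : cmod z <= (1 + Num.min 1 (delta / 8)) * cmod (h l * y).
    by rewrite (le_trans zz1) // ler_wpM2r ?cmod_ge0 // lerD2l.
  rewrite (le_trans t1) // -!mulrA ler_wpM2l //.
  by rewrite cmodM [cmod y * _]mulrC mulrA ler_wpM2r // ltW.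
have zy2 : cmod y <= (1 + Num.min 1 (delta / 8)) *
    ((1 + Num.min 1 (delta / 8)) * cmod (z / h (0 +i* w))).
  rewrite cmodM cmodV -(ler_pM2l cl) -cmodM.
  have t1 : cmod (h l * y) <= (1 + Num.min 1 (delta / 8)) * cmod z.
    by rewrite (le_trans zz2) // ler_wpM2r ?cmod_ge0 // lerD2l.
  rewrite (le_trans t1) //.
  have -> : cmod (h l) * ((1 + Num.min 1 (delta / 8)) * ((1 + Num.min 1 (delta / 8)) *
      (cmod z / cmod (h (0 +i* w))))) = (1 + Num.min 1 (delta / 8)) * (cmod z *
      ((1 + Num.min 1 (delta / 8)) * cmod (h l) / cmod (h (0 +i* w)))) by ring.
  rewrite ler_wpM2l //.
  by rewrite ler_peMr ?cmod_ge0 // ler_pdivlMr // mul1r.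
have kd' : Num.min 1 (delta / 8) <= delta / 8 by rewrite ge_min lexx orbT.
have n1 := @ln_ratio _ _ _ (ltac:(by rewrite cmod_gt0) : 0 < cmod (z / h (0 +i* w))) cy k0 zy1.
have n2 := @ln_ratio _ _ _ cy (ltac:(by rewrite cmod_gt0) : 0 < cmod (z / h (0 +i* w))) k0 zy2.
have i1 := Im_le_cmod (l - ib); rewrite ImB /= in i1.
have i2 : `|complex.Im l - w| <= `|complex.Im l - b| + `|w - b|.
  by rewrite (distrC w) -{1}(subrKA b) ler_normD.
have r1 : `|complex.Re l / eps + ln (cmod (z / h (0 +i* w)))| <= delta / 4.
  move: n1 n2 kd'; rewrite lny ler_norml; clear - P rho0 Du => n1 n2 kd'.
  by apply/andP; split; lra.
by move: r1 i1 i2 wb lk kd kpos; clear - P rho0 Du; lra.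
Qed.

Lemma pseudo_continuous_near_axis Rb delta : 0 < delta ->
  exists2 e, 0 < e & forall eps l, 0 < eps -> `|complex.Re l| < e ->
    `|complex.Im l| <= Rb -> pseudo_continuous rho A B eps l ->
    exists2 mu, asym_continuous rho A B mu & cmod (rescale eps l - mu) < delta.
Proof.
move=> delta0.
(* [Q e b] is the claim at the single height [b] for a strip of half-width [e]; compactness of the
   segment yields one [e] for all heights. *)
pose Q (e b : R) := forall eps l, 0 < eps -> `|complex.Re l| < e ->
  complex.Im l = b -> pseudo_continuous rho A B eps l ->
  exists2 mu, asym_continuous rho A B mu & cmod (rescale eps l - mu) < delta.
have cov : \forall e \near (0 : R)^'+, `[- Rb, Rb] `<=` Q e.
  have /compact_near_coveringP := @segment_compact R (- Rb) Rb; apply.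
  move=> b _; have [e e0 He] := pseudo_continuous_local b delta0.
  have e20 : 0 < e / 2 by lra.
  exists (ball b (e / 2), [set t | t < e / 2]).
    by split; [exact: nbhsx_ballx|exact: nbhs_right_lt].
  move=> [b' t] [/= bb' te] eps l eps0 Rl Il pl.
  have {}bb' : `|b - b'| < e / 2 := bb'.
  apply: He pl => //; apply: (le_lt_trans (cmod_le_ReIm _)).
  by rewrite ReB ImB /= subr0 Il distrC; lra.
have e0near : \forall e \near (0 : R)^'+, 0 < e := nbhs_right_gt 0.
have [e He e0] : exists2 e : R, `[- Rb, Rb] `<=` Q e & 0 < e.
  near (0 : R)^'+ => e; exists e; [exact: (near cov e)|exact: (near e0near e)].
exists e => // eps l eps0 Rl Il; apply: (He (complex.Im l)) => //=.
by rewrite in_itv /= -ler_norml.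
Unshelve. all: by end_near.
Qed.

End Accumulation.

(** * Existence of spectrum near each point of the asymptotic continuous spectrum *)

Section Existence.
Context {R : realType}.
Local Notation C := (R[i]).
Implicit Types (p : {poly C}) (y u l a : C) (G : {poly {poly C}}).

(** The first-order estimate of [exp] shows that [y * cexp (- u)] stays at distance between
    [s |y| / 2] and [4 s |y|] from [y], and [s] is small enough to keep it away from the other roots
    of [p]. The radius [2 * s] bounds the modulus on the square of half-side [s]. *)
Lemma annulus_lower_bound p y e : p != 0 -> y != 0 -> 0 < e ->
  exists s c, [/\ 0 < s, s <= e, s <= 1 / 16, 0 < c &
    forall u, s <= cmod u <= 2 * s -> c <= cmod p.[y * cexp (- u)]].
Proof.
move=> p0 y0 e0; have [t t0 Ht] := isolated_roots y p0.
have cy : 0 < cmod y by rewrite cmod_gt0.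
pose s := Num.min (Num.min e (1 / 16)) (t / (8 * cmod y)).
have s0 : 0 < s.
  have h : 0 < 1 / 16 :> R by lra.
  by rewrite !lt_min e0 h divr_gt0 ?mulr_gt0.
have s1 : s <= 1 / 16 by rewrite !ge_min lexx orbT.
have st : 8 * (s * cmod y) <= t.
  have : s <= t / (8 * cmod y) by rewrite ge_min lexx orbT.
  by rewrite ler_pdivlMr ?mulr_gt0 // mulrCA.
pose r := Num.min (s * cmod y / 2) (t / 2).
have sy0 : 0 < s * cmod y by rewrite mulr_gt0.
have r0 : 0 < r by rewrite lt_min; apply/andP; split; lra.
have [c c0 Hc] := nonroot_lower_bound p0 r0.
exists s, c; split=> //; first by rewrite !ge_min lexx.
move=> u /andP[su us]; apply: Hc => v rv.
have /cexp_dist1/andP[lo hi] : cmod (- u) <= 1 / 8 by rewrite cmodN; lra.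
rewrite cmodN in lo hi.
have yE : cmod (y * cexp (- u) - y) = cmod y * cmod (cexp (- u) - 1).
  by rewrite -cmodM mulrBr mulr1.
have lo' : s * cmod y / 2 <= cmod (y * cexp (- u) - y).
  by rewrite yE -mulrA mulrCA ler_pM2l //; lra.
have hi' : cmod (y * cexp (- u) - y) <= 4 * (s * cmod y).
  by rewrite yE mulrA mulrC ler_pM2r //; lra.
have [->|vy] := eqVneq v y; first by rewrite ge_min lo'.
have tv : t <= cmod (v - y).
  rewrite leNgt; apply/negP => vt; have /Ht/negP : 0 < cmod (v - y) < t.
    by rewrite cmod_gt0 subr_eq0 vy.
  by apply.
rewrite ge_min; apply/orP; right.
by have := cmod_dist (y * cexp (- u)) v y; rewrite (cmodB v (y * _)); lra.
Qed.

Lemma cexp_2pi_int (k : int) : cexp (0 +i* (pi *+ 2 * k%:~R)) = 1 :> C.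
Proof.
have E n : cexp (0 +i* (pi *+ 2 * n%:R)) = 1 :> C.
  have -> : 0 +i* (pi *+ 2 * n%:R) = (0 +i* (pi *+ 2)) *+ n :> C.
    rewrite mulr_natr; move: (pi *+ 2) => t; elim: n => // n IH.
    by rewrite !mulrS -IH; simpc.
  by rewrite cexpX cexp_imag cos2pi sin2pi expr1n.
case: k => n; first exact: E.
rewrite NegzE mulrNz mulrN.
have := E n.+1; set t := pi *+ 2 * _ => Et.
have : cexp (0 +i* (- t)) * cexp (0 +i* t) = 1 :> C.
  by rewrite -cexpD -cexp0; congr cexp; simpc; rewrite addNr.
by rewrite Et mulr1.
Qed.

(** [exp (- i v / eps)] has period [2 pi eps] in [v], so the prescribed phase recurs within that
    distance of [w]. *)
Lemma phase_adjustment (eps w phi : R) : 0 < eps -> exists2 v,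
  `|v - w| <= pi *+ 2 * eps & cexp (- ((0 +i* v) / eps%:C)) = cexp (- (0 +i* phi)) :> C.
Proof.
move=> eps0; have p0 : 0 < pi *+ 2 :> R by rewrite pmulrn_lgt0 // pi_gt0.
pose q := (w / eps - phi) / (pi *+ 2); pose k := Num.floor q.
have /andP[k1 k2] := floor_itv q; rewrite -/k in k1 k2.
exists (eps * (phi + pi *+ 2 * k%:~R)).
  have wE : w = eps * (phi + pi *+ 2 * q).
    rewrite /q [pi *+ 2 * _]mulrC divfK ?gt_eqF // [phi + _]addrC subrK.
    by rewrite mulrC divfK ?gt_eqF.
  have -> : eps * (phi + pi *+ 2 * k%:~R) - w = - (pi *+ 2 * eps * (q - k%:~R)).
    by rewrite {1}wE; ring.
  rewrite normrN normrM (gtr0_norm (mulr_gt0 p0 eps0)) ler_piMr ?mulr_ge0 ?ltW //.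
  by rewrite intrD in k2; rewrite ger0_norm; lra.
have -> : (0 +i* (eps * (phi + pi *+ 2 * k%:~R))) / eps%:C =
    0 +i* phi + 0 +i* (pi *+ 2 * k%:~R).
  apply: (@mulIf _ eps%:C); first by rewrite -cmod_gt0 cmod_real normr_gt0 gt_eqF.
  rewrite mulfVK; last by rewrite -cmod_gt0 cmod_real normr_gt0 gt_eqF.
  by simpc; rewrite mulrC.
have h := cexp_2pi_int k; set z := 0 +i* (_ * _) in h *.
have hN : cexp (- z) = 1 by rewrite -[LHS]mulr1 -h -cexpD addNr cexp0.
by rewrite opprD cexpD hN mulr1.
Qed.

Lemma sinhc_composite_close G (y a : C) (rho c : R) : 0 < c ->
  exists2 e, 0 < e & forall l u, cmod (l - a) < e -> cmod u <= 1 ->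
    cmod (G.[y * cexp (- u) * sinhc (l * rho%:C), l] -
          G.[y * cexp (- u) * sinhc (a * rho%:C), a]) < c.
Proof.
move=> c0; pose M := cmod y * expR 1 + 1; pose s := sinhc (a * rho%:C).
have M0 : 0 < M by rewrite ltr_wpDl ?mulr_ge0 ?cmod_ge0 ?expR_ge0.
have s0 := cmod_ge0 s; have a0 := cmod_ge0 a.
pose K := M * (cmod s + 1) + cmod a + 1.
have Ms0 : 0 <= M * (cmod s + 1) by rewrite mulr_ge0 //; lra.
have K0 : 0 <= K by rewrite /K; lra.
have [L L0 HL] := biv_lipschitz G K0.
pose t := Num.min 1 (c / (4 * L * M)).
have t0 : 0 < t by rewrite lt_min ltr01 divr_gt0 // !mulr_gt0.
have t1 : t <= 1 by rewrite ge_min lexx.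
have tc : t * (4 * L * M) <= c.
  by rewrite -ler_pdivlMr ?mulr_gt0 // ge_min lexx orbT.
have [e e0 He] := poly_approximable_continuous a
  (poly_approximable_comp_affine 0 rho%:C sinhc_approximable) t0.
exists (Num.min e (Num.min 1 (c / (4 * L)))) => [|l u].
  by rewrite !lt_min e0 ltr01 divr_gt0 // mulr_gt0.
rewrite !lt_min => /and3P[le l1 lL] u1.
have {le}sl : cmod (sinhc (l * rho%:C) - s) < t.
  by move: (He l le); rewrite !add0r ![rho%:C * _]mulrC.
set x := y * cexp (- u); have xM : cmod x <= M.
  rewrite /M cmodM ler_wpDr // ler_wpM2l ?cmod_ge0 //.
  by rewrite (le_trans (cmod_cexp_le _)) // ler_expR cmodN.
have sl1 : cmod (sinhc (l * rho%:C)) <= cmod s + 1.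
  by have := cmod_le_add (sinhc (l * rho%:C) - s) s; rewrite subrK; lra.
have x1 : cmod (x * sinhc (l * rho%:C)) <= K.
  rewrite cmodM /K -addrA ler_wpDr ?addr_ge0 // ler_pM ?cmod_ge0 //.
have x2 : cmod (x * s) <= K.
  rewrite cmodM /K -addrA ler_wpDr ?addr_ge0 // ler_pM ?cmod_ge0 //; lra.
have lK : cmod l <= K.
  by rewrite /K; have := cmod_le_add (l - a) a; rewrite subrK; lra.
have aK : cmod a <= K by rewrite /K; lra.
have [_ h] := HL _ _ l a x1 x2 lK aK.
apply: (le_lt_trans h); rewrite -mulrBr cmodM.
have h1 : cmod x * cmod (sinhc (l * rho%:C) - s) <= M * t.
  by rewrite ler_pM ?cmod_ge0 // ltW.
have h2 : L * cmod (l - a) < c / 4.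
  by move: lL; rewrite ltr_pdivlMr ?mulr_gt0 //; clear; lra.
have h3 : L * (cmod x * cmod (sinhc (l * rho%:C) - s)) <= L * (M * t) by rewrite ler_pM2l.
by rewrite mulrDr; clear - h2 h3 tc c0; lra.
Qed.

Variables (m d : nat) (rho : R) (A1 : 'M[R]_m) (A2 : 'M[R]_(m, d)).
Variables (A3 : 'M[R]_(d, m)) (A4 D : 'M[R]_d).
Hypotheses (rho0 : 0 < rho) (Du : D \in unitmx).
Let A := block_mx A1 A2 A3 A4.
Let B : 'M[R]_(m + d) := block_mx 0 0 0 D.
Let P := biv_char A B.

Lemma sep_radius_le_Re v : asym_strong A v ->
  (sep_radius A <= (`|complex.Re v| / 3)%:E)%E.
Proof.
move=> Av; rewrite /sep_radius mulrC EFinM lee_pmul2l // ge_min.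
apply/orP; right; apply: ereal_inf_lbound; exists v, (0 +i* complex.Im v); split=> //.
congr EFin; rewrite -cmod_real; congr cmod.
by case: v {Av} => a b; apply/eqP; rewrite eq_complex /= subr0 subrr !eqxx.
Qed.

(** The separation radius is at most [|Re v| / 3] for each [v] in [asym_strong], so a strong
    spectral point near [v] has real part at least [2 |Re v| / 3] in modulus; and [v] ranges over
    finitely many roots off the axis. *)
Lemma not_strong_near_axis : exists2 k, 0 < k & forall eps l,
  `|complex.Re l| < k -> ~ strong_spectrum rho A B eps l.
Proof.
have P0 : P`_0 != 0 by exact: const_coef_neq0.
have Pd : P`_d != 0 by exact: lead_coef_neq0.
have PP : P`_0 * P`_d != 0 by rewrite mulf_neq0.
have [r pr _] := poly_roots PP.
have [k k0 Hk] := seq_pos_lower_bound r (fun v => `|complex.Re v|).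
have far v l : asym_strong A v -> complex.Re v != 0 -> root (P`_0 * P`_d) v ->
    ((cmod (l - v))%:E < sep_radius A)%E -> k / 2 <= `|complex.Re l|.
  move=> Av Rv rv lv; have := Hk v; rewrite -(root_prod _ PP pr) rv normr_gt0 Rv.
  move=> /(_ isT isT) kv.
  have := lt_le_trans lv (sep_radius_le_Re Av); rewrite lte_fin => lv'.
  have := Re_le_cmod (l - v); rewrite ReB distrC => h.
  by have := ler_normD (complex.Re v - complex.Re l) (complex.Re l); rewrite subrK; lra.
exists (k / 2) => [|eps l lk]; first by lra.
case=> [] [_ [v Av lv]]; have [sv Rv] := Av.
- have : k / 2 <= `|complex.Re l|; last by lra.
  apply: (far v) => //; [by left|by rewrite gt_eqF|].
  by rewrite rootM biv_char_coef0; apply/orP; left; apply/mx_spectrum_root.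
- have : k / 2 <= `|complex.Re l|; last by lra.
  apply: (far v) => //; [by right|by rewrite lt_eqF|].
  rewrite rootM biv_char_coef_lead rootZ ?det_lead_neq0 //; apply/orP; right.
  by apply/mx_spectrum_root; rewrite -(block_mxKul A1 A2 A3 A4).
Qed.


Lemma pseudo_continuous_exists mu delta : asym_continuous rho A B mu -> 0 < delta ->
  exists2 eps0, 0 < eps0 & forall eps, 0 < eps < eps0 ->
    exists2 l, pseudo_continuous rho A B eps l & cmod (rescale eps l - mu) < delta.
Proof.
move=> Amu delta0; have d20 : (0 : C) < (delta / 2)%:C by rewrite ltcR; lra.
(* Half of [delta] is spent on replacing [mu], a point of a closure, by a point [g + i w] of the set
   itself. *)
have [_ [[g [w [-> nw [phi pw]]]] muE]] := Amu _ (nbhsx_ballx (mu : C^o) _ d20).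
have {}muE : cmod (mu - g +i* w) < delta / 2.
  by move: muE; rewrite -ball_normE /= normrC_cmod ltcR.
set y := cexp _ * cexp _ in pw; have y0 : y != 0 by rewrite mulf_neq0 ?cexp_neq0.
pose iw : C := 0 +i* w; pose s0 := sinhc (iw * rho%:C).
pose p := at_param iw P \Po (s0 *: 'X).
have pE x : p.[x] = P.[x * s0, iw].
  by rewrite horner_comp hornerZ hornerX horner_at_param [s0 * x]mulrC.
have p0 : p != 0.
  apply/eqP => p0; apply: nw; apply: strong_critical_of_p_omega => x.
  by rewrite p_omega_biv // -pE p0 horner0.
have py : p.[y] = 0 by rewrite pE -[RHS]pw p_omega_biv.
have [s [c [spos sd s16 c0 Hs]]] := annulus_lower_bound p0 y0
  (ltac:(by lra) : 0 < delta / 8).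
have c40 : 0 < c / 4 by lra.
have [e1 e10 H1] := sinhc_composite_close P y iw rho c40.
have P0 : P`_0 != 0 by exact: const_coef_neq0.
have [e2 e20 H2] := isolated_roots iw P0.
have [e3 e30 H3] := not_strong_near_axis.
pose e := Num.min (Num.min e1 e2) (Num.min e3 (delta / 8)).
have e0 : 0 < e by rewrite !lt_min e10 e20 e30 /=; lra.
have ee1 : e <= e1 by rewrite !ge_min lexx.
have ee2 : e <= e2 by rewrite !ge_min lexx orbT.
have ee3 : e <= e3 by rewrite !ge_min lexx !orbT.
have ed : e <= delta / 8 by rewrite !ge_min lexx !orbT.
(* [T * eps] bounds [|q.[u] - i w|] for [|u| <= 1]: [2 pi eps] comes from the phase adjustment, the
   rest from [eps (g + u)]. *)
pose T : R := pi *+ 2 + `|g| + 1.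
have T0 : 0 < T.
  have : 0 < pi *+ 2 :> R by rewrite pmulrn_lgt0 // pi_gt0.
  by rewrite /T; have := normr_ge0 g; lra.
exists (e / T) => [|eps /andP[eps0 epsT]]; first by rewrite divr_gt0.
have {}epsT : T * eps < e by rewrite mulrC -ltr_pdivlMr.
have [v vw vphi] := phase_adjustment w phi eps0.
have epsC : eps%:C != 0 by rewrite -cmod_gt0 cmod_real normr_gt0 gt_eqF.
(* In the coordinate [u], [exp (- q.[u] / eps)] equals [y exp (- u)] for every [eps]; the other
   occurrences of [q.[u]] tend to [i w]. *)
pose q : {poly C} := (0 +i* v + eps%:C * g%:C)%:P + eps%:C *: 'X.
have qE u : q.[u] = 0 +i* v + eps%:C * (g%:C + u).
  by rewrite hornerD hornerC hornerZ hornerX mulrDr addrA.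
have q_near u : cmod u <= 1 -> cmod (q.[u] - iw) < e.
  move=> u1; have -> : q.[u] - iw = (0 +i* v - iw) + eps%:C * (g%:C + u).
    by rewrite qE; ring.
  apply: le_lt_trans (cmod_le_add _ _) _; rewrite cmod_imag_sub cmodM cmod_real.
  rewrite (gtr0_norm eps0).
  have : eps * cmod (g%:C + u) <= eps * (`|g| + 1).
    by rewrite ler_pM2l // (le_trans (cmod_le_add _ _)) // cmod_real lerD2l.
  by move: epsT vw; rewrite /T; clear - P rho0 Du; lra.
have expE u : cexp (- (q.[u] / eps%:C)) = y * cexp (- u).
  rewrite qE mulrDl [eps%:C * _]mulrC mulfK // !opprD !cexpD vphi /y.
  by rewrite [RHS]mulrAC [RHS]mulrC.
pose f u := P.[y * cexp (- u) * sinhc (q.[u] * rho%:C), q.[u]].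
have fE u : f u = char_fun rho A B eps q.[u] by rewrite char_fun_biv expE.
have fa : poly_approximable f.
  have cexpNa : poly_approximable (fun u => cexp (- u)).
    move=> K r r0; have [h Hh] := poly_approximable_comp_affine 0 (-1) cexp_approximable K r0.
    by exists h => z zK; have := Hh z zK; rewrite add0r mulN1r.
  have sinhcqa : poly_approximable (fun u => sinhc (q.[u] * rho%:C)).
    move=> K r r0; have [h Hh] := poly_approximable_comp_affine
      ((0 +i* v + eps%:C * g%:C) * rho%:C) (eps%:C * rho%:C) sinhc_approximable K r0.
    exists h => z zK; have := Hh z zK.
    have -> : (0 +i* v + eps%:C * g%:C) * rho%:C + eps%:C * rho%:C * z = q.[z] * rho%:C.
      by rewrite qE; ring.
    by [].
  apply: poly_approximable_biv; apply: poly_approximable_mul => //.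
  by apply: poly_approximable_mul => //; exact: poly_approximable_const.
(* The limit [p.[y * cexp (- u)]] vanishes at [u = 0] and has modulus at least [c] on the annulus,
   so an error below [c / 4] separates [|f 0|] from [|f u|] at the level [c / 2]. *)
have f_near u : cmod u <= 1 -> cmod (f u - p.[y * cexp (- u)]) < c / 4.
  move=> u1; rewrite pE; apply: H1 => //.
  exact: lt_le_trans (q_near u u1) ee1.
have f0 : cmod (f 0) < c / 2.
  have := f_near 0; rewrite oppr0 cexp0 mulr1 py subr0 cmod0 => /(_ ler01).
  by move: c0; clear - P rho0 Du; lra.
have fs u : square s u -> s <= cmod u -> c / 2 <= cmod (f u).
  move=> squ su; have u2 := square_cmod squ.
  have u1 : cmod u <= 1 by move: u2 s16; clear - P rho0 Du; lra.
  have := Hs u; rewrite su u2 => /(_ isT).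
  have := f_near u u1; have := cmod_sub_ge p.[y * cexp (- u)] (f u).
  by rewrite (cmodB (f u)); move: c0; clear - P rho0 Du; lra.
have [u us fu] := zero_in_square spos fa f0 fs.
have u1 : cmod u <= 1 by move: us s16; clear - P rho0 Du; lra.
have qe := q_near u u1; exists q.[u].
  split; first by rewrite /spectrum /= -fE.
  case=> [|sc].
    apply: H3; apply: le_lt_trans (lt_le_trans qe ee3).
    by have := Re_le_cmod (q.[u] - iw); rewrite ReB subr0.
  (* Within [e2] of [i w] the only possible root of the constant coefficient is [i w], which is not
     strong critical. *)
  have [qiw|qiw] := eqVneq q.[u] iw; first by apply: nw; rewrite -/iw -qiw.
  have /H2/negP : 0 < cmod (q.[u] - iw) < e2.
    by rewrite cmod_gt0 subr_eq0 qiw (lt_le_trans qe).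
  by apply; exact: strong_critical_root sc.
have Req : complex.Re q.[u] / eps = g + complex.Re u.
  rewrite qE; case: (u) => u1' u2'; simpc; rewrite /= mulrC mulKf // gt_eqF //.
have h1 := Im_le_cmod (q.[u] - iw); rewrite ImB /= in h1.
have h2 := Re_le_cmod u.
apply: (le_lt_trans (cmod_dist (g +i* w) _ _)); rewrite (cmodB (g +i* w)).
have : cmod (rescale eps q.[u] - g +i* w) <= `|complex.Re u| + `|complex.Im q.[u] - w|.
  apply: le_trans (cmod_le_ReIm _) _.
  by rewrite ReB ImB /= Req [g + _]addrC addrK.
by move: muE h1 h2 us sd ed qe delta0; clear - P rho0 Du; lra.
Qed.

End Existence.

(** * The two approximation statements *)

Theorem theoremA3 (R : realType) (m d : nat) (d_gt0 : (0 < d)%N)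
    (rho : R) (rho_gt0 : 0 < rho)
    (A1 : 'M[R]_m) (A2 : 'M[R]_(m, d)) (A3 : 'M[R]_(d, m)) (A4 : 'M[R]_d)
    (Bbar : 'M[R]_d) (Bbar_unit : Bbar \in unitmx)
    (A B : 'M[R]_(m + d))
    (A_block : A = block_mx A1 A2 A3 A4) (B_block : B = block_mx 0 0 0 Bbar) :
  (forall (mu : R[i]) (delta : R),
     asym_continuous rho A B mu -> 0 < delta ->
     exists eps0 : R, 0 < eps0 <= rho^-1 /\
       forall eps : R, 0 < eps < eps0 ->
         exists l : R[i], pseudo_continuous rho A B eps l /\
           cmod (rescale eps l - mu) < delta)
  /\
  (forall Rb : R, 0 < Rb ->
   forall delta : R, 0 < delta -> (delta%:E <= sep_radius A)%E ->
     exists eps0 : R, 0 < eps0 <= rho^-1 /\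
       forall (eps : R) (l : R[i]), 0 < eps < eps0 ->
         pseudo_continuous rho A B eps l -> `|complex.Im l| < Rb ->
         `|complex.Re l| < delta /\
         exists mu : R[i], asym_continuous rho A B mu /\
           cmod (rescale eps l - mu) < delta).
Proof.
have rV0 : 0 < rho^-1 by rewrite invr_gt0.
subst A B; split=> [mu delta Amu delta0|Rb Rb0 delta delta0 deltar].
  have [e e0 He] := pseudo_continuous_exists Bbar_unit Amu delta0.
  exists (Num.min e rho^-1); split; first by rewrite lt_min e0 rV0 ge_min lexx orbT.
  move=> eps; rewrite lt_min => /andP[eps0 /andP[epse _]].
  have [|l pl lmu] := He eps; first by rewrite eps0.
  by exists l.
have [e1 e10 H1] := @pseudo_continuous_near_axis
  _ _ _ _ A1 A2 A3 A4 _ rho_gt0 Bbar_unit Rb _ delta0.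
(* The real part must satisfy the required bound and also lie in the strip where the compactness
   argument applies. *)
pose delta' := Num.min delta e1.
have delta'0 : 0 < delta' by rewrite lt_min delta0.
have delta'r : (delta'%:E <= sep_radius (block_mx A1 A2 A3 A4))%E.
  by apply: le_trans deltar; rewrite lee_fin ge_min lexx.
have [e2 e20 H2] := pseudo_continuous_Re_small rho_gt0 Bbar_unit Rb delta'0 delta'r.
exists (Num.min e2 rho^-1); split; first by rewrite lt_min e20 rV0 ge_min lexx orbT.
move=> eps l; rewrite lt_min => /andP[eps0 /andP[epse _]] pl Il.
have := H2 eps l; rewrite eps0 epse => /(_ isT pl Il); rewrite lt_min => /andP[Rd Re1].
split=> //; have [mu Amu lmu] := H1 eps l eps0 Re1 (ltW Il) pl.
by exists mu.
Qed.
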